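(* Let $H$ be a Hopf algebra over a field $k$ with bijective antipode $S$. Let $H_{cop}$ be the coopposite Hopf algebra, and let $H\triangleright\!\!\!\blacktriangleleft H_{cop}$ be the bicrossproduct given by the right action of $H$ on $H_{cop}$, $g\triangleleft h=S(h_{(1)})\,g\,h_{(2)}$, and the left coaction of $H_{cop}$ on $H$, $\delta(h)=S(h_{(1)})h_{(3)}\otimes h_{(2)}$, for $h\in H$, $g\in H_{cop}$ (Sweedler indices with respect to the coproduct of $H$). Then $(H\triangleright\!\!\!\blacktriangleleft H_{cop},\,S^{-1})$, with $\phi=S^{-1}:(H_{cop})^{op}\to H$, is a bicrossed module of Hopf algebras.
   Context: Sumless Sweedler notation: $\Delta(h)=h_{(1)}\otimes h_{(2)}$ for coproducts and $\delta(c)=c^{[-1]}\otimes c^{[0]}$ for left coactions. $B^{op}$ (resp. $B_{cop}$) is $B$ with opposite product (resp. opposite coproduct). When $S$ is bijective, $H_{cop}$ is a Hopf algebra with antipode $S^{-1}$. **Module algebra, comodule coalgebra.** A right $H$-module algebra is an algebra $A$ with a right $H$-action $\triangleleft$ such that $(ab)\triangleleft h=(a\triangleleft h_{(1)})(b\triangleleft h_{(2)})$ and $1\triangleleft h=\varepsilon(h)1$. A left $H$-comodule coalgebra is a coalgebra $C$ with a left $H$-coaction such that $c^{[-1]}\otimes c^{[0]}{}_{(1)}\otimes c^{[0]}{}_{(2)}=c_{(1)}{}^{[-1]}c_{(2)}{}^{[-1]}\otimes c_{(1)}{}^{[0]}\otimes c_{(2)}{}^{[0]}$ and $c^{[-1]}\varepsilon(c^{[0]})=\varepsilon(c)1$.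 **Bicrossproduct.** Let $A,B$ be Hopf algebras such that (i) $A$ is a left $B$-comodule coalgebra with coaction $\delta$ and $B$ is a right $A$-module algebra with action $\triangleleft$; (ii) $\varepsilon(b\triangleleft a)=\varepsilon(b)\varepsilon(a)$ and $\delta(1)=1\otimes 1$; (iii) $(b\triangleleft a)_{(1)}\otimes(b\triangleleft a)_{(2)}=(b_{(1)}\triangleleft a_{(1)})\,a_{(2)}{}^{[-1]}\otimes b_{(2)}\triangleleft a_{(2)}{}^{[0]}$; (iv) $a_{(1)}{}^{[-1]}(b\triangleleft a_{(2)})\otimes a_{(1)}{}^{[0]}=(b\triangleleft a_{(1)})\,a_{(2)}{}^{[-1]}\otimes a_{(2)}{}^{[0]}$; (v) $\delta(aa')=(a^{[-1]}\triangleleft a'_{(1)})\,a'_{(2)}{}^{[-1]}\otimes a^{[0]}a'_{(2)}{}^{[0]}$. The bicrossproduct $A\triangleright\!\!\!\blacktriangleleft B$ is the Hopf algebra with underlying vector space $A\otimes B$, product $(a\otimes b)(a'\otimes b')=aa'_{(1)}\otimes(b\triangleleft a'_{(2)})b'$, unit $1\otimes 1$, coproduct $\Delta(a\otimes b)=a_{(1)}\otimes a_{(2)}{}^{[-1]}b_{(1)}\otimes a_{(2)}{}^{[0]}\otimes b_{(2)}$, counit $\varepsilon(a\otimes b)=\varepsilon(a)\varepsilon(b)$, and antipode $S(a\otimes b)=S(a^{[0]}{}_{(2)})\otimes S(a^{[-1]}b)\triangleleft S(a^{[0]}{}_{(1)})$. It is a known result of Majid that, for $H$ with bijective antipode, $A=H$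 and $B=H_{cop}$ with the action and coaction in the claim form a bicrossproduct. **Bicrossed module of Hopf algebras.** This is a pair $(A\triangleright\!\!\!\blacktriangleleft B,\phi)$ where $A\triangleright\!\!\!\blacktriangleleft B$ is a bicrossproduct of Hopf algebras $A,B$, the antipode of $A$ is bijective, and $\phi:B^{op}\to A$ is a bialgebra morphism such that for all $a\in A$, $b,b'\in B$: (1) $\phi(b)^{[-1]}\otimes\phi(b)^{[0]}=b_{(1)}S_B(b_{(3)})\otimes\phi(b_{(2)})$; (2) $\phi(a^{[-1]})\otimes a^{[0]}=S_A^{-1}(a_{(3)})a_{(1)}\otimes a_{(2)}$; (3) $\phi(b\triangleleft a)=S_A^{-1}(a_{(2)})\,\phi(b)\,a_{(1)}$; (4) $b'\triangleleft\phi(b)=b_{(1)}b'S_B(b_{(2)})$. Here $S_A,S_B$ are the antipodes of $A,B$, and Sweedler indices of elements of $B$ refer to the coproduct of $B$ (so for $B=H_{cop}$, to the coopposite coproduct, with $S_B=S^{-1}$). *)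

(* Defs.v *)
From HB Require Import structures.
From mathcomp Require Import all_boot all_order all_algebra.
From mathcomp Require Import boolp classical_sets.

Set Implicit Arguments.
Unset Strict Implicit.
Unset Printing Implicit Defensive.

Import GRing.Theory.

Local Open Scope ring_scope.
Local Open Scope quotient_scope.

Definition bilin (k : fieldType) (V W U : lmodType k) (f : V -> W -> U) : Prop :=
  (forall w, linear (f^~ w)) /\ (forall v, linear (f v)).

Section Tensor.
Variables (k : fieldType) (V W : lmodType k).

(* A finite list of pairs stands for a formal sum of pure tensors, and two formal
   sums are identified when every bilinear map into every vector space takes the
   same value on both. The universal property is [tens_bilin], [sweedler_tens],
   [sweedler_linear] (existence) and [tensor_ext] (uniqueness). *)
Definition formal_eval (U : nmodType) (f : V -> W -> U) (s : seq (V * W)) : U :=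
  \sum_(p <- s) f p.1 p.2.

Definition formal_eq (s t : seq (V * W)) : bool :=
  `[< forall (U : lmodType k) (f : V -> W -> U), bilin f ->
        formal_eval f s = formal_eval f t >].

Lemma formal_eq_refl : reflexive formal_eq.
Proof. by move=> s; apply/asboolP. Qed.

Lemma formal_eq_sym : symmetric formal_eq.
Proof.
by move=> s t; apply/asboolP/asboolP => h U f bf; rewrite h.
Qed.

Lemma formal_eq_trans : transitive formal_eq.
Proof.
move=> t s u /asboolP h1 /asboolP h2; apply/asboolP => U f bf.
by rewrite h1 // h2.
Qed.

Canonical formal_equiv :=
  EquivRel formal_eq formal_eq_refl formal_eq_sym formal_eq_trans.

Definition tensor : Type := {eq_quot formal_eq}.
HB.instance Definition _ := Choice.on tensor.
HB.instance Definition _ := EqQuotient.on tensor.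

Implicit Types (x y z t : tensor) (a b : k).

(* [sweedler f t], written [\Sw_(v, w <- t) f v w], is the sum of the f v w over
   a chosen finite decomposition of t into pure tensors. It is meaningful when f
   is bilinear: it then does not depend on the decomposition, and it is the
   linear map on V ⊗ W induced by f. *)
Definition sweedler (U : nmodType) (f : V -> W -> U) (t : tensor) : U :=
  formal_eval f (repr t).

Lemma sweedler_pi (U : lmodType k) (f : V -> W -> U) s :
  bilin f -> sweedler f (\pi_tensor s) = formal_eval f s.
Proof.
move=> bf; rewrite /sweedler.
have : formal_eq (repr (\pi_tensor s)) s.
  by apply/eqmodP; rewrite reprK.
by move/asboolP; apply.
Qed.

Lemma tensorP x y :
  (forall (U : lmodType k) (f : V -> W -> U), bilin f ->
     sweedler f x = sweedler f y) -> x = y.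
Proof.
move=> h; rewrite -[x]reprK -[y]reprK; apply/eqmodP/asboolP => U f bf.
exact: h.
Qed.

Definition tens (v : V) (w : W) : tensor := \pi_tensor [:: (v, w)].
Definition tensor0 : tensor := \pi_tensor [::].
Definition tensorD x y : tensor := \pi_tensor (repr x ++ repr y).
Definition tensorZ a x : tensor := \pi_tensor [seq (a *: p.1, p.2) | p <- repr x].

Lemma sweedler0 (U : lmodType k) (f : V -> W -> U) :
  bilin f -> sweedler f tensor0 = 0.
Proof. by move=> bf; rewrite sweedler_pi // /formal_eval big_nil. Qed.

Lemma sweedlerD (U : lmodType k) (f : V -> W -> U) x y :
  bilin f -> sweedler f (tensorD x y) = sweedler f x + sweedler f y.
Proof. by move=> bf; rewrite sweedler_pi // /formal_eval big_cat. Qed.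

Lemma sweedlerZ (U : lmodType k) (f : V -> W -> U) a x :
  bilin f -> sweedler f (tensorZ a x) = a *: sweedler f x.
Proof.
move=> bf; rewrite sweedler_pi // /formal_eval big_map scaler_sumr.
by apply: eq_bigr => p _ /=; rewrite (scalable_linear (bf.1 _)).
Qed.

Lemma tensorDA : associative tensorD.
Proof. by move=> x y z; apply: tensorP => U f bf; rewrite !sweedlerD ?addrA. Qed.

Lemma tensorDC : commutative tensorD.
Proof. by move=> x y; apply: tensorP => U f bf; rewrite !sweedlerD // addrC. Qed.

Lemma tensor0D : left_id tensor0 tensorD.
Proof. by move=> x; apply: tensorP => U f bf; rewrite sweedlerD // sweedler0 // add0r. Qed.

Lemma tensorND : left_inverse tensor0 (tensorZ (-1)) tensorD.
Proof.
move=> x; apply: tensorP => U f bf.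
by rewrite sweedlerD // sweedlerZ // sweedler0 // scaleN1r addNr.
Qed.

HB.instance Definition _ := GRing.isZmodule.Build tensor tensorDA tensorDC tensor0D tensorND.

Lemma tensorZA a b x : tensorZ a (tensorZ b x) = tensorZ (a * b) x.
Proof. by apply: tensorP => U f bf; rewrite !sweedlerZ // scalerA. Qed.

Lemma tensor1Z : left_id 1 tensorZ.
Proof. by move=> x; apply: tensorP => U f bf; rewrite sweedlerZ // scale1r. Qed.

Lemma tensorZDr : right_distributive tensorZ +%R.
Proof.
by move=> a x y; apply: tensorP => U f bf;
  rewrite sweedlerZ // !sweedlerD // !sweedlerZ // scalerDr.
Qed.

Lemma tensorZDl x : {morph tensorZ^~ x : a b / a + b}.
Proof.
by move=> a b; apply: tensorP => U f bf;
  rewrite sweedlerD // !sweedlerZ // scalerDl.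
Qed.

HB.instance Definition _ :=
  GRing.Zmodule_isLmodule.Build k tensor tensorZA tensor1Z tensorZDr tensorZDl.

End Tensor.

Arguments tensor {k} (V W)%_type_scope.

Notation "V ⊗ W" := (tensor V W) (at level 40, left associativity) : type_scope.
Notation "v ⊗ w" := (tens v w) (at level 40, left associativity) : ring_scope.

Notation "\Sw_ ( x , y <- t ) F" := (sweedler (fun x y => F) t)
  (at level 41, x name, y name, t at level 70, F at level 41,
   format "'[' \Sw_ ( x ,  y  <-  t ) '/  '  F ']'") : ring_scope.

Section TensorUniversal.
Variables (k : fieldType) (V W : lmodType k).

Lemma sweedler_tens (U : lmodType k) (f : V -> W -> U) v w :
  bilin f -> sweedler f (v ⊗ w) = f v w.
Proof. by move=> bf; rewrite sweedler_pi // /formal_eval big_seq1. Qed.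

Lemma sweedler_linear (U : lmodType k) (f : V -> W -> U) :
  bilin f -> linear (sweedler f).
Proof. by move=> bf a x y; rewrite sweedlerD // sweedlerZ. Qed.

Lemma tens_bilin : bilin (@tens k V W).
Proof.
split=> [w a v v' | v a w w']; apply: tensorP => U f bf;
  rewrite (sweedler_linear bf) !sweedler_tens //.
  exact: bf.1.
exact: bf.2.
Qed.

Lemma linear_sweedler (U : lmodType k) (U' : lmodType k) (g : U -> U')
  (f : V -> W -> U) t :
  linear g -> g (sweedler f t) = \Sw_(x, y <- t) g (f x y).
Proof.
move=> lg; pose h := HB.pack_for {linear U -> U'} g (GRing.isLinear.Build _ _ _ _ g lg).
exact: (linear_sum h).
Qed.

Lemma sweedler_id (t : V ⊗ W) : \Sw_(x, y <- t) (x ⊗ y) = t.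
Proof.
apply: tensorP => U f bf; rewrite (linear_sweedler _ _ (sweedler_linear bf)).
by apply: eq_bigr => p _; rewrite sweedler_tens.
Qed.

Lemma tensor_ext (U : lmodType k) (g h : V ⊗ W -> U) :
  linear g -> linear h -> (forall v w, g (v ⊗ w) = h (v ⊗ w)) -> g =1 h.
Proof.
move=> lg lh gh t; rewrite -(sweedler_id t) !linear_sweedler //.
by apply: eq_bigr => p _; rewrite gh.
Qed.

End TensorUniversal.

Section Structures.
Variables (k : fieldType) (V : lmodType k).

Record is_algebra (mul : V -> V -> V) (one : V) : Prop := IsAlgebra {
  algebra_bilin : bilin mul;
  algebra_mulA : associative mul;
  algebra_1mul : left_id one mul;
  algebra_mul1 : right_id one mul }.

Record is_coalgebra (comul : V -> V ⊗ V) (counit : V -> k) : Prop := IsCoalgebra {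
  coalgebra_comul_linear : linear comul;
  coalgebra_counit_linear : scalar counit;
  coalgebra_coassoc : forall c,
    \Sw_(x, y <- comul c) \Sw_(x1, x2 <- comul x) x1 ⊗ (x2 ⊗ y) =
    \Sw_(x, y <- comul c) \Sw_(y1, y2 <- comul y) x ⊗ (y1 ⊗ y2);
  coalgebra_counitl : forall c, \Sw_(x, y <- comul c) counit x *: y = c;
  coalgebra_counitr : forall c, \Sw_(x, y <- comul c) counit y *: x = c }.

Record is_bialgebra (mul : V -> V -> V) (one : V)
    (comul : V -> V ⊗ V) (counit : V -> k) : Prop := IsBialgebra {
  bialgebra_algebra : is_algebra mul one;
  bialgebra_coalgebra : is_coalgebra comul counit;
  bialgebra_comulM : forall x y, comul (mul x y) =
    \Sw_(x1, x2 <- comul x) \Sw_(y1, y2 <- comul y) mul x1 y1 ⊗ mul x2 y2;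
  bialgebra_comul1 : comul one = one ⊗ one;
  bialgebra_counitM : forall x y, counit (mul x y) = counit x * counit y;
  bialgebra_counit1 : counit one = 1 }.

Record is_hopf_algebra (mul : V -> V -> V) (one : V)
    (comul : V -> V ⊗ V) (counit : V -> k) (antipode : V -> V) : Prop :=
  IsHopfAlgebra {
  hopf_bialgebra : is_bialgebra mul one comul counit;
  hopf_antipode_linear : linear antipode;
  hopf_antipodel : forall x,
    \Sw_(x1, x2 <- comul x) mul (antipode x1) x2 = counit x *: one;
  hopf_antipoder : forall x,
    \Sw_(x1, x2 <- comul x) mul x1 (antipode x2) = counit x *: one }.

End Structures.

Record bialgebra (k : fieldType) := Bialgebra {
  bialgebra_alg :> algType k;
  comul : bialgebra_alg -> bialgebra_alg ⊗ bialgebra_alg;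
  counit : bialgebra_alg -> k;
  bialgebraP : is_bialgebra *%R 1 comul counit }.

Record hopf_algebra (k : fieldType) := HopfAlgebra {
  hopf_alg :> bialgebra k;
  antipode : hopf_alg -> hopf_alg;
  hopfP : is_hopf_algebra *%R 1 (@comul _ hopf_alg) (@counit _ hopf_alg) antipode }.

Arguments comul {k b} _.
Arguments counit {k b} _.
Arguments antipode {k h} _.

Section Linearity.
Variable k : fieldType.

Lemma lin_id (U : lmodType k) : linear (fun x : U => x). Proof. by []. Qed.

Lemma lin_comp (U U' U'' : lmodType k) (g : U' -> U'') (f : U -> U') :
  linear g -> linear f -> linear (fun x => g (f x)).
Proof. by move=> lg lf a x y; rewrite lf lg. Qed.

Lemma lin_sum (U V W U' : lmodType k) (F : U -> V -> W -> U') (t : V ⊗ W) :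
  (forall x y, linear (fun u => F u x y)) -> linear (fun u => sweedler (F u) t).
Proof.
move=> lF a u v; rewrite /sweedler /formal_eval.
under eq_bigr do rewrite lF.
by rewrite big_split scaler_sumr.
Qed.

Lemma lin_sw (U V W U' : lmodType k) (g : U -> V ⊗ W) (F : V -> W -> U') :
  linear g -> bilin F -> linear (fun u => sweedler F (g u)).
Proof. by move=> lg bF; apply: lin_comp lg; apply: sweedler_linear. Qed.

Lemma lin_tensl (U V W : lmodType k) (f : U -> V) (w : W) :
  linear f -> linear (fun u => f u ⊗ w).
Proof. by move=> lf a x y; rewrite lf (tens_bilin V W).1. Qed.

Lemma lin_tensr (U V W : lmodType k) (f : U -> W) (v : V) :
  linear f -> linear (fun u => v ⊗ f u).
Proof. by move=> lf a x y; rewrite lf (tens_bilin V W).2. Qed.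

Lemma lin_mull (U : lmodType k) (A : algType k) (f : U -> A) (c : A) :
  linear f -> linear (fun u => f u * c).
Proof. by move=> lf a x y; rewrite lf mulrDl scalerAl. Qed.

Lemma lin_mulr (U : lmodType k) (A : algType k) (f : U -> A) (c : A) :
  linear f -> linear (fun u => c * f u).
Proof. by move=> lf a x y; rewrite lf mulrDr scalerAr. Qed.

Lemma lin_scalel (U V : lmodType k) (f : U -> k) (v : V) :
  scalar f -> linear (fun u => f u *: v).
Proof. by move=> lf a x y; rewrite lf scalerDl scalerA. Qed.

Lemma lin_scaler (U V : lmodType k) (f : U -> V) (c : k) :
  linear f -> linear (fun u => c *: f u).
Proof. by move=> lf a x y; rewrite lf scalerDr !scalerA mulrC. Qed.

Lemma scal_comp (U U' : lmodType k) (g : U' -> k) (f : U -> U') :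
  scalar g -> linear f -> scalar (fun x => g (f x)).
Proof. by move=> lg lf a x y; rewrite lf lg. Qed.

Lemma scal_mull (U : lmodType k) (f : U -> k) (c : k) :
  scalar f -> scalar (fun x => f x * c).
Proof. by move=> lf a x y; rewrite lf mulrDl mulrA. Qed.

Lemma scal_mulr (U : lmodType k) (f : U -> k) (c : k) :
  scalar f -> scalar (fun x => c * f x).
Proof. by move=> lf a x y; rewrite lf mulrDr mulrCA. Qed.

Lemma comul_linear (B : bialgebra k) : linear (@comul k B).
Proof. exact: coalgebra_comul_linear (bialgebra_coalgebra (bialgebraP B)). Qed.

Lemma counit_scalar (B : bialgebra k) : scalar (@counit k B).
Proof. exact: coalgebra_counit_linear (bialgebra_coalgebra (bialgebraP B)). Qed.

Lemma antipode_linear (H : hopf_algebra k) : linear (@antipode k H).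
Proof. exact: hopf_antipode_linear (hopfP H). Qed.

End Linearity.

Ltac lin := lazymatch goal with
  | |- bilin _ => split=> ?; cbv beta; lin
  | |- forall _, _ => move=> ?; cbv beta; lin
  | |- _ => first
  [ assumption
  | exact: lin_id
  | apply: lin_sum => ? ?; cbv beta; lin
  | apply: lin_sw; [cbv beta; lin | lin]
  | apply: lin_tensl; lin
  | apply: lin_tensr; lin
  | apply: lin_mull; lin
  | apply: lin_mulr; lin
  | apply: lin_scaler; lin
  | apply: lin_scalel; lin
  | exact: comul_linear
  | exact: counit_scalar
  | exact: antipode_linear
  | apply: scal_comp; [exact: counit_scalar | lin]
  | apply: lin_comp; [exact: comul_linear | lin]
  | apply: lin_comp; [exact: antipode_linear | lin]
  | apply: lin_comp; [eassumption | lin] ] end.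

Lemma alg_is_algebra (k : fieldType) (A : algType k) :
  is_algebra (@GRing.mul A) 1.
Proof.
split; [split=> [c|c] | exact: mulrA | exact: mul1r | exact: mulr1].
  exact: lin_mull (@lin_id k A).
exact: lin_mulr (@lin_id k A).
Qed.

Section Calculus.
Variables (k : fieldType).

Lemma eq_sw (V W : lmodType k) (U : nmodType) (f g : V -> W -> U) (t : V ⊗ W) :
  (forall x y, f x y = g x y) -> sweedler f t = sweedler g t.
Proof. by move=> fg; apply: eq_bigr => p _; apply: fg. Qed.

Lemma sw_exch (V W V' W' : lmodType k) (U : nmodType)
    (f : V -> W -> V' -> W' -> U) (s : V ⊗ W) (t : V' ⊗ W') :
  \Sw_(x, y <- s) \Sw_(x', y' <- t) f x y x' y' =
  \Sw_(x', y' <- t) \Sw_(x, y <- s) f x y x' y'.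
Proof. exact: exchange_big. Qed.

Lemma sw_sw (V W V' W' U : lmodType k) (f : V -> W -> U) (g : V' -> W' -> V ⊗ W)
    (t : V' ⊗ W') :
  bilin f -> sweedler f (sweedler g t) = \Sw_(x, y <- t) sweedler f (g x y).
Proof. by move=> bf; rewrite (linear_sweedler _ _ (sweedler_linear bf)). Qed.

Lemma coassoc (B : bialgebra k) (U : lmodType k) (f : B -> B -> B -> U) (b : B) :
  (forall y z, linear (fun x => f x y z)) ->
  (forall x z, linear (fun y => f x y z)) ->
  (forall x y, linear (f x y)) ->
  \Sw_(x, z <- comul b) \Sw_(x1, x2 <- comul x) f x1 x2 z =
  \Sw_(x, z <- comul b) \Sw_(z1, z2 <- comul z) f x z1 z2.
Proof.
move=> f1 f2 f3.
have bf x : bilin (fun y z => f x y z) by split=> *; [exact: f2 | exact: f3].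
have bF : bilin (fun x t => \Sw_(y, z <- t) f x y z).
  split=> [t|x]; first by apply: lin_sum => y z; exact: f1.
  exact: sweedler_linear.
have lG := sweedler_linear bF.
set G := sweedler _ in lG.
have GE x y z : G (x ⊗ (y ⊗ z)) = f x y z by rewrite /G !sweedler_tens.
have := congr1 G (coalgebra_coassoc (bialgebra_coalgebra (bialgebraP B)) b).
rewrite !(linear_sweedler _ _ lG) => e.
transitivity (\Sw_(x, y <- comul b) G (\Sw_(x1, x2 <- comul x) x1 ⊗ (x2 ⊗ y))).
  by apply: eq_sw => x y; rewrite (linear_sweedler _ _ lG); apply: eq_sw => *.
by rewrite e; apply: eq_sw => x y; rewrite (linear_sweedler _ _ lG); apply: eq_sw.
Qed.

Lemma counitl (B : bialgebra k) (b : B) : \Sw_(x, y <- comul b) counit x *: y = b.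
Proof. exact: coalgebra_counitl (bialgebra_coalgebra (bialgebraP B)) b. Qed.

Lemma counitr (B : bialgebra k) (b : B) : \Sw_(x, y <- comul b) counit y *: x = b.
Proof. exact: coalgebra_counitr (bialgebra_coalgebra (bialgebraP B)) b. Qed.

Lemma counitl_lin (B : bialgebra k) (U : lmodType k) (g : B -> U) (b : B) :
  linear g -> \Sw_(x, y <- comul b) counit x *: g y = g b.
Proof.
move=> lg; rewrite -[in RHS](counitl b) linear_sweedler //.
by apply: eq_sw => x y; rewrite (scalable_linear lg).
Qed.

Lemma counitr_lin (B : bialgebra k) (U : lmodType k) (g : B -> U) (b : B) :
  linear g -> \Sw_(x, y <- comul b) counit y *: g x = g b.
Proof.
move=> lg; rewrite -[in RHS](counitr b) linear_sweedler //.
by apply: eq_sw => x y; rewrite (scalable_linear lg).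
Qed.

Lemma sw_mulr (V W : lmodType k) (A : algType k) (f : V -> W -> A) c (t : V ⊗ W) :
  c * sweedler f t = \Sw_(x, y <- t) (c * f x y).
Proof. exact: mulr_sumr. Qed.

Lemma sw_mull (V W : lmodType k) (A : algType k) (f : V -> W -> A) c (t : V ⊗ W) :
  sweedler f t * c = \Sw_(x, y <- t) (f x y * c).
Proof. exact: mulr_suml. Qed.

End Calculus.

Section Opposites.
Variables (k : fieldType).

Definition tswap (V W : lmodType k) (t : V ⊗ W) : W ⊗ V := \Sw_(x, y <- t) y ⊗ x.

Lemma tswap_linear (V W : lmodType k) : linear (@tswap V W).
Proof. by apply: sweedler_linear; lin. Qed.

Lemma sw_tswap (V W U : lmodType k) (f : W -> V -> U) (t : V ⊗ W) :
  bilin f -> sweedler f (tswap t) = \Sw_(x, y <- t) f y x.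
Proof. by move=> bf; rewrite sw_sw //; apply: eq_sw => x y; rewrite sweedler_tens. Qed.

Lemma tswap_sw (V W V' W' : lmodType k) (f : V' -> W' -> V ⊗ W) (t : V' ⊗ W') :
  tswap (sweedler f t) = \Sw_(x, y <- t) tswap (f x y).
Proof. exact: linear_sweedler (@tswap_linear V W). Qed.

Lemma tswap_tens (V W : lmodType k) (v : V) (w : W) : tswap (v ⊗ w) = w ⊗ v.
Proof. by rewrite /tswap sweedler_tens //; lin. Qed.

Section Cop.
Variable B : bialgebra k.

Definition cop_comul (b : B) : B ⊗ B := tswap (comul b).

Lemma cop_comul_linear : linear cop_comul.
Proof. exact: lin_comp (@tswap_linear B B) (@comul_linear k B). Qed.

Lemma cop_coalgebra : is_coalgebra cop_comul counit.
Proof.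
split; [exact: cop_comul_linear | exact: counit_scalar | move=> c | move=> c | move=> c].
- have lc := cop_comul_linear.
  rewrite !sw_tswap; [ | lin..].
  under eq_sw do (rewrite sw_tswap; [ | lin..]).
  under [RHS]eq_sw do (rewrite sw_tswap; [ | lin..]).
  by rewrite -(@coassoc k B _ (fun a b c => c ⊗ (b ⊗ a))); [by [] | lin..].
- by rewrite /cop_comul sw_tswap; [exact: counitr | lin].
- by rewrite /cop_comul sw_tswap; [exact: counitl | lin].
Qed.

Lemma cop_bialgebraP : is_bialgebra (@GRing.mul B) 1 cop_comul counit.
Proof.
have HB := bialgebraP B.
split; [exact: alg_is_algebra | exact: cop_coalgebra | | | |].
- move=> x y; rewrite /cop_comul (bialgebra_comulM HB) sw_tswap; last by lin.
  rewrite tswap_sw; apply: eq_sw => x1 x2; rewrite tswap_sw sw_tswap; last by lin.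
  by apply: eq_sw => y1 y2; rewrite tswap_tens.
- by rewrite /cop_comul (bialgebra_comul1 HB) tswap_tens.
- exact: bialgebra_counitM HB.
- exact: bialgebra_counit1 HB.
Qed.

Definition cop : bialgebra k := Bialgebra cop_bialgebraP.

End Cop.

Section Op.
Variable B : bialgebra k.

(* B^op is given by [op_mul] and the unit, coproduct and counit of B. *)
Definition op_mul (x y : B) : B := y * x.

Lemma op_bialgebraP : is_bialgebra op_mul 1 (@comul k B) counit.
Proof.
have HB := bialgebraP B; rewrite /op_mul.
split; [ | exact: bialgebra_coalgebra HB | | | |].
- by split; [lin | move=> x y z; rewrite mulrA | exact: mulr1 | exact: mul1r].
- by move=> x y; rewrite (bialgebra_comulM HB) sw_exch.
- exact: bialgebra_comul1 HB.
- by move=> x y; rewrite (bialgebra_counitM HB) mulrC.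
- exact: bialgebra_counit1 HB.
Qed.

End Op.

Section Antipode.
Variable H : hopf_algebra k.
Implicit Types x y h : H.

Lemma antipodel h : \Sw_(x, y <- comul h) antipode x * y = counit h *: 1.
Proof. exact: hopf_antipodel (hopfP H) h. Qed.

Lemma antipoder h : \Sw_(x, y <- comul h) x * antipode y = counit h *: 1.
Proof. exact: hopf_antipoder (hopfP H) h. Qed.

Lemma antipode1 : antipode (1 : H) = 1.
Proof.
have HB := bialgebraP H; have := antipodel 1.
rewrite (bialgebra_comul1 HB) (bialgebra_counit1 HB) scale1r => e.
rewrite -[RHS]e sweedler_tens ?mulr1 //; lin.
Qed.

Lemma antipodeM x y : antipode (x * y) = antipode y * antipode x.
Proof.
have HB := bialgebraP H; set S := @antipode k H.
have lS : linear S := @antipode_linear k H.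
pose g x1 x2 x3 y1 y2 y3 : H := S (x1 * y1) * (x2 * y2) * (S y3 * S x3).
pose f x1 x2 x3 : H :=
  \Sw_(y1, y' <- comul y) \Sw_(y2, y3 <- comul y') g x1 x2 x3 y1 y2 y3.
have fE x1 x2 x3 : f x1 x2 x3 = S (x1 * y) * (x2 * S x3).
  rewrite -(@counitr_lin k H _ (fun y => S (x1 * y) * (x2 * S x3))); last by lin.
  apply: eq_sw => y1 y'.
  transitivity (\Sw_(y2, y3 <- comul y') (S (x1 * y1) * x2 * (y2 * S y3) * S x3)).
    by apply: eq_sw => y2 y3; rewrite /g !mulrA.
  by rewrite -sw_mull -sw_mulr antipoder -scalerAr mulr1 -scalerAl mulrA.
have fE' x' x3 : \Sw_(x1, x2 <- comul x') f x1 x2 x3 = counit x' *: (S y * S x3).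
  transitivity (\Sw_(x1, x2 <- comul x') \Sw_(y', y3 <- comul y)
      \Sw_(y1, y2 <- comul y') g x1 x2 x3 y1 y2 y3).
    by apply: eq_sw => x1 x2; rewrite /f /g coassoc //; lin.
  rewrite sw_exch -(@counitl_lin k H _ (fun y => counit x' *: (S y * S x3))); last by lin.
  apply: eq_sw => y' y3.
  transitivity (\Sw_(x1, x2 <- comul x')
      (\Sw_(y1, y2 <- comul y') S (x1 * y1) * (x2 * y2)) * (S y3 * S x3)).
    by apply: eq_sw => x1 x2; rewrite sw_mull.
  rewrite -sw_mull scalerA -[counit y' * _]mulrC -(bialgebra_counitM HB).
  rewrite -[in RHS](mul1r (S y3 * S x3)) scalerAl -antipodel (bialgebra_comulM HB).
  congr (_ * _); rewrite sw_sw; last by lin.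
  apply: eq_sw => x1 x2; rewrite sw_sw; last by lin.
  by apply: eq_sw => y1 y2; rewrite sweedler_tens //; lin.
transitivity (\Sw_(x1, x' <- comul x) \Sw_(x2, x3 <- comul x') f x1 x2 x3).
  rewrite -(@counitr_lin k H _ (fun x => S (x * y))); last by lin.
  apply: eq_sw => x1 x'; rewrite (eq_sw _ (fE x1)) -sw_mulr antipoder.
  by rewrite -scalerAr mulr1.
rewrite -coassoc; first last.
- by rewrite /f /g; lin.
- by rewrite /f /g; lin.
- by rewrite /f /g; lin.
rewrite -(@counitl_lin k H _ (fun x => S y * S x)); last by lin.
by apply: eq_sw => x' x3; rewrite fE'.
Qed.

(* The inverse of the antipode when the latter is bijective; in general,
   elements outside its image are sent to 0. *)
Definition antipode_inv (h : H) : H := xget 0 [set x : H | antipode x = h]%classic.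

Hypothesis antipode_bij : bijective (@antipode k H).

Lemma antipode_invK : cancel antipode_inv antipode.
Proof.
move=> h; rewrite /antipode_inv; case: xgetP => [x _ //|].
by case: antipode_bij => g _ gK /(_ (g h)); rewrite /= gK.
Qed.

Lemma antipodeK : cancel antipode antipode_inv.
Proof. by move=> h; apply: (bij_inj antipode_bij); rewrite antipode_invK. Qed.

Lemma antipode_inv_linear : linear antipode_inv.
Proof.
move=> a x y; apply: (bij_inj antipode_bij).
by rewrite antipode_linear !antipode_invK.
Qed.

Lemma cop_hopfP :
  is_hopf_algebra *%R 1 (@comul k (cop H)) (@counit k (cop H)) antipode_inv.
Proof.
have Sinj := bij_inj antipode_bij; have lS := @antipode_linear k H.
have lSi := antipode_inv_linear.
split; [exact: (bialgebraP (cop H)) | exact: antipode_inv_linear | move=> x | move=> x];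
  apply: Sinj; rewrite [@comul _ _ _]/(tswap (@comul k H x)) sw_tswap; try by lin.
  rewrite linear_sweedler // (scalable_linear lS) antipode1.
  rewrite -[RHS](antipodel (x : H)).
  by apply: eq_sw => x1 x2; rewrite antipodeM antipode_invK.
rewrite linear_sweedler // (scalable_linear lS) antipode1.
  rewrite -[RHS](antipoder (x : H)).
by apply: eq_sw => x1 x2; rewrite antipodeM antipode_invK.
Qed.

Definition cop_hopf : hopf_algebra k := HopfAlgebra cop_hopfP.

End Antipode.
End Opposites.

Section Bicrossproduct.
Variable k : fieldType.

Record is_bialgebra_morphism (V W : lmodType k)
    (mulV : V -> V -> V) (oneV : V) (comulV : V -> V ⊗ V) (counitV : V -> k)
    (mulW : W -> W -> W) (oneW : W) (comulW : W -> W ⊗ W) (counitW : W -> k)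
    (f : V -> W) : Prop := IsBialgebraMorphism {
  morphism_linear : linear f;
  morphism_mul : forall x y, f (mulV x y) = mulW (f x) (f y);
  morphism_one : f oneV = oneW;
  morphism_comul : forall x, comulW (f x) = \Sw_(x1, x2 <- comulV x) f x1 ⊗ f x2;
  morphism_counit : forall x, counitW (f x) = counitV x }.

Record is_right_module_algebra (H : bialgebra k) (A : algType k)
    (act : A -> H -> A) : Prop := IsRightModuleAlgebra {
  act_bilin : bilin act;
  act1 : forall a, act a 1 = a;
  actM : forall a h h', act a (h * h') = act (act a h) h';
  mul_act : forall a b h,
    act (a * b) h = \Sw_(h1, h2 <- comul h) act a h1 * act b h2;
  one_act : forall h, act 1 h = counit h *: 1 }.

Record is_left_comodule_coalgebra (H C : bialgebra k)
    (coact : C -> H ⊗ C) : Prop := IsLeftComoduleCoalgebra {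
  coact_linear : linear coact;
  coact_coassoc : forall c,
    \Sw_(h, c0 <- coact c) \Sw_(h1, h2 <- comul h) h1 ⊗ (h2 ⊗ c0) =
    \Sw_(h, c0 <- coact c) \Sw_(h', c0' <- coact c0) h ⊗ (h' ⊗ c0');
  coact_counit : forall c, \Sw_(h, c0 <- coact c) counit h *: c0 = c;
  comul_coact : forall c,
    \Sw_(h, c0 <- coact c) \Sw_(c1, c2 <- comul c0) h ⊗ (c1 ⊗ c2) =
    \Sw_(c1, c2 <- comul c) \Sw_(h, c10 <- coact c1) \Sw_(h', c20 <- coact c2)
      (h * h') ⊗ (c10 ⊗ c20);
  counit_coact : forall c,
    \Sw_(h, c0 <- coact c) counit c0 *: h = counit c *: 1 }.

Section Pair.
Variables (A B : hopf_algebra k) (act : B -> A -> B) (coact : A -> B ⊗ A).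

Local Notation "b ◁ a" := (act b a) (at level 39, left associativity).

Record bicrossproduct_conditions : Prop := BicrossproductConditions {
  bicross_comodule_coalgebra : is_left_comodule_coalgebra coact;
  bicross_module_algebra : is_right_module_algebra act;
  bicross_counit_act : forall (b : B) (a : A), counit (b ◁ a) = counit b * counit a;
  bicross_coact1 : coact 1 = 1 ⊗ 1;
  bicross_comul_act : forall (b : B) (a : A), comul (b ◁ a) =
    \Sw_(b1, b2 <- comul b) \Sw_(a1, a2 <- comul a) \Sw_(c, a20 <- coact a2)
      ((b1 ◁ a1) * c) ⊗ (b2 ◁ a20);
  bicross_act_coact : forall (b : B) (a : A),
    \Sw_(a1, a2 <- comul a) \Sw_(c, a10 <- coact a1) (c * (b ◁ a2)) ⊗ a10 =
    \Sw_(a1, a2 <- comul a) \Sw_(c, a20 <- coact a2) ((b ◁ a1) * c) ⊗ a20;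
  bicross_coactM : forall a a' : A, coact (a * a') =
    \Sw_(c, a0 <- coact a) \Sw_(a'1, a'2 <- comul a') \Sw_(c', a'20 <- coact a'2)
      ((c ◁ a'1) * c') ⊗ (a0 * a'20) }.

Definition bicross_mul (x y : A ⊗ B) : A ⊗ B :=
  \Sw_(a, b <- x) \Sw_(a', b' <- y) \Sw_(a'1, a'2 <- comul a')
    (a * a'1) ⊗ ((b ◁ a'2) * b').

Definition bicross_one : A ⊗ B := 1 ⊗ 1.

Definition bicross_comul (x : A ⊗ B) : (A ⊗ B) ⊗ (A ⊗ B) :=
  \Sw_(a, b <- x) \Sw_(a1, a2 <- comul a) \Sw_(c, a20 <- coact a2)
    \Sw_(b1, b2 <- comul b) (a1 ⊗ (c * b1)) ⊗ (a20 ⊗ b2).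

Definition bicross_counit (x : A ⊗ B) : k :=
  \Sw_(a, b <- x) counit a * counit b.

Definition bicross_antipode (x : A ⊗ B) : A ⊗ B :=
  \Sw_(a, b <- x) \Sw_(c, a0 <- coact a) \Sw_(a01, a02 <- comul a0)
    antipode a02 ⊗ (antipode (c * b) ◁ antipode a01).

Record is_bicrossproduct : Prop := IsBicrossproduct {
  bicrossproduct_cond : bicrossproduct_conditions;
  bicrossproduct_hopf : is_hopf_algebra
    bicross_mul bicross_one bicross_comul bicross_counit bicross_antipode }.

Record is_bicrossed_module (phi : B -> A) : Prop := IsBicrossedModule {
  bicrossed_bicrossproduct : is_bicrossproduct;
  bicrossed_antipode_bij : bijective (@antipode k A);
  bicrossed_morphism : is_bialgebra_morphism
    (@op_mul k B) 1 comul counit *%R 1 comul counit phi;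
  bicrossed_coact_phi : forall b : B, coact (phi b) =
    \Sw_(b1, b' <- comul b) \Sw_(b2, b3 <- comul b') (b1 * antipode b3) ⊗ phi b2;
  bicrossed_phi_coact : forall a : A,
    \Sw_(c, a0 <- coact a) phi c ⊗ a0 =
    \Sw_(a1, a' <- comul a) \Sw_(a2, a3 <- comul a') (antipode_inv a3 * a1) ⊗ a2;
  bicrossed_phi_act : forall (b : B) (a : A), phi (b ◁ a) =
    \Sw_(a1, a2 <- comul a) antipode_inv a2 * phi b * a1;
  bicrossed_act_phi : forall b b' : B, b' ◁ phi b =
    \Sw_(b1, b2 <- comul b) b1 * b' * antipode b2 }.

End Pair.

Section Adjoint.
Variable H : hopf_algebra k.

(* On underlying vector spaces H_cop is H, so these serve as an action of H on
   H_cop and a coaction of H_cop on H. *)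
Definition adj_act (g h : H) : H :=
  \Sw_(h1, h2 <- comul h) antipode h1 * g * h2.

Definition adj_coact (h : H) : H ⊗ H :=
  \Sw_(h1, h' <- comul h) \Sw_(h2, h3 <- comul h') (antipode h1 * h3) ⊗ h2.

End Adjoint.
End Bicrossproduct.

(* Main.v *)
Require Import Defs.
From mathcomp Require Import all_boot all_order all_algebra.

(** The twist a ⊗ b |-> a_1 ⊗ a_2 b, with inverse a ⊗ b |-> a_1 ⊗ S(a_2) b, carries
    the bicrossproduct of H and H_cop for the adjoint action and coaction to the
    tensor product Hopf algebra H ⊗ H_cop, so that the Hopf algebra axioms need not
    be checked on the bicrossproduct itself. The remaining conditions are Sweedler
    computations in which h_1 (g ◁ h_2) = g h and a_1 a_2^[-1] ⊗ a_2^[0] = a_2 ⊗ a_1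
    perform all the cancellations, together with the anti-comultiplicativity of S. *)

Set Implicit Arguments.
Unset Strict Implicit.
Unset Printing Implicit Defensive.

Import GRing.Theory.

Local Open Scope ring_scope.

(** The action is inner: g ◁ h is conjugation by the identity map of H, whose convolution inverse is
    S. A smash product by an inner action of this kind untwists to the plain tensor product; the
    coaction is inner in the dual sense, and one linear map undoes both at once. The dual
    cancellation exchanges two tensorands, which is why the second factor has to carry the
    coopposite coproduct. H, [cop H] and [cop_hopf] share one underlying algebra, so the
    computations are done with the coproduct of H, and indices are reversed only where a coproduct
    of H_cop is unfolded. Since [sweedler] works on a chosen decomposition, regrouping by
    coassociativity needs multilinearity of the summand; the basic cancellations are therefore
    stated for an arbitrary bilinear [f], ready to be used inside a larger expression. *)

Section TensorCalculus.
Variable k : fieldType.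

(** * Linear and bilinear maps out of tensor products *)

Lemma linZ (V W : lmodType k) (f : V -> W) :
  linear f -> forall a v, f (a *: v) = a *: f v.
Proof. by move=> lf a v; exact: (scalable_linear lf). Qed.

Lemma bilin_comp (V W V' W' U : lmodType k)
    (h : V' -> W' -> U) (f : V -> V') (g : W -> W') :
  bilin h -> linear f -> linear g -> bilin (fun x y => h (f x) (g y)).
Proof.
move=> [h1 h2] lf lg.
by split=> z; [exact: (lin_comp (h1 _))|exact: (lin_comp (h2 _))].
Qed.

Lemma sw_scale (V W U : lmodType k) (f : V -> W -> U) (c : k) (t : V ⊗ W) :
  \Sw_(x, y <- t) (c *: f x y) = c *: sweedler f t.
Proof. by rewrite (@linear_sweedler _ _ _ _ _ (fun u => c *: u)) //; lin. Qed.

Lemma tensor_ext2 (A B C D U : lmodType k) (f g : A ⊗ B -> C ⊗ D -> U) :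
  bilin f -> bilin g ->
  (forall a b c d, f (a ⊗ b) (c ⊗ d) = g (a ⊗ b) (c ⊗ d)) ->
  forall x y, f x y = g x y.
Proof.
move=> [f1 f2] [g1 g2] fg x y; apply: (tensor_ext (f1 y) (g1 y)) => a b.
by apply: (tensor_ext (f2 _) (g2 _)) => c d.
Qed.

Lemma tens_scalel (V W : lmodType k) (a : k) (v : V) (w : W) :
  (a *: v) ⊗ w = a *: (v ⊗ w).
Proof. exact: (scalable_linear ((tens_bilin V W).1 w)). Qed.

Lemma tens_scaler (V W : lmodType k) (a : k) (v : V) (w : W) :
  v ⊗ (a *: w) = a *: (v ⊗ w).
Proof. exact: (scalable_linear ((tens_bilin V W).2 v)). Qed.

Definition tmap (V W V' W' : lmodType k) (f : V -> V') (g : W -> W') (t : V ⊗ W) :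
  V' ⊗ W' := \Sw_(x, y <- t) f x ⊗ g y.

Lemma tmap_linear (V W V' W' : lmodType k) (f : V -> V') (g : W -> W') :
  linear f -> linear g -> linear (tmap f g).
Proof. by move=> lf lg; apply: sweedler_linear; lin. Qed.

Lemma tmap_tens (V W V' W' : lmodType k) (f : V -> V') (g : W -> W') v w :
  linear f -> linear g -> tmap f g (v ⊗ w) = f v ⊗ g w.
Proof. by move=> lf lg; rewrite /tmap sweedler_tens //; lin. Qed.

Lemma sw_tmap (V W V' W' U : lmodType k) (f : V -> V') (g : W -> W')
    (h : V' -> W' -> U) (t : V ⊗ W) :
  bilin h -> sweedler h (tmap f g t) = \Sw_(x, y <- t) h (f x) (g y).
Proof. by move=> bh; rewrite sw_sw //; apply: eq_sw => x y; rewrite sweedler_tens. Qed.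

End TensorCalculus.

(** * The tensor product of two Hopf algebras *)

Section TensorHopf.
Variables (k : fieldType).

Section Mul.
Variables A B : algType k.

Definition tmul (x y : A ⊗ B) : A ⊗ B :=
  \Sw_(a, b <- x) \Sw_(a', b' <- y) (a * a') ⊗ (b * b').

Lemma tmul_bilin : bilin tmul.
Proof. by rewrite /tmul; lin. Qed.

Lemma tmul_tens a b a' b' : tmul (a ⊗ b) (a' ⊗ b') = (a * a') ⊗ (b * b').
Proof. by rewrite /tmul !sweedler_tens //; lin. Qed.

Lemma tmul_algebra : is_algebra tmul (1 ⊗ 1).
Proof.
have [l1 l2] := tmul_bilin.
split; first exact: tmul_bilin.
- move=> x y z; move: x.
  apply: tensor_ext; [by lin|by apply: lin_comp; lin|move=> a b].
  move: y z; apply: tensor_ext2.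
  + split=> z; first by apply: lin_comp; lin.
    by apply: lin_comp; lin.
  + split=> z; last by lin.
    by apply: lin_comp; [exact: l1|lin].
  by move=> *; rewrite !tmul_tens !mulrA.
- by apply: tensor_ext => [|//|a b]; [lin | rewrite tmul_tens !mul1r].
- by apply: tensor_ext => [|//|a b]; [lin | rewrite tmul_tens !mulr1].
Qed.

End Mul.

Section Bialgebra.
Variables A B : bialgebra k.

Definition tcomul (x : A ⊗ B) : (A ⊗ B) ⊗ (A ⊗ B) :=
  \Sw_(a, b <- x) \Sw_(a1, a2 <- comul a) \Sw_(b1, b2 <- comul b)
    (a1 ⊗ b1) ⊗ (a2 ⊗ b2).

Definition tcounit (x : A ⊗ B) : k := \Sw_(a, b <- x) counit a * counit b.

(** The codomain is [k^o], the field as a module over itself, because [bilin] asks for a module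
    where the counits give bare scalars. *)
Lemma tcounit_bilin : @bilin k A B k^o (fun a b => counit a * counit b).
Proof.
split=> c; first exact: scal_mull (@counit_scalar k A).
exact: scal_mulr (@counit_scalar k B).
Qed.

Lemma tcounit_scalar : scalar tcounit.
Proof. exact: sweedler_linear tcounit_bilin. Qed.

Lemma tcounit_tens a b : tcounit (a ⊗ b) = counit a * counit b.
Proof. exact: sweedler_tens tcounit_bilin. Qed.

Lemma tcomul_linear : linear tcomul.
Proof. by rewrite /tcomul; lin. Qed.

Lemma sw_tcomul_tens (U : lmodType k) (f : A ⊗ B -> A ⊗ B -> U) a b :
  bilin f -> sweedler f (tcomul (a ⊗ b)) =
  \Sw_(a1, a2 <- comul a) \Sw_(b1, b2 <- comul b) f (a1 ⊗ b1) (a2 ⊗ b2).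
Proof.
move=> bf; rewrite /tcomul sweedler_tens; last by lin.
rewrite sw_sw //; apply: eq_sw => a1 a2; rewrite sw_sw //; apply: eq_sw => b1 b2.
by rewrite sweedler_tens.
Qed.

Lemma tensor_coalgebra : is_coalgebra tcomul tcounit.
Proof.
have lc := tcomul_linear; have ls := tcounit_scalar.
split=> //.
- apply: tensor_ext; [lin|lin|move=> a b].
  rewrite !sw_tcomul_tens; [ | lin..].
  (* Coassociativity is used in one factor at a time; the sums over the other factor are then part
     of the summand. *)
  transitivity (\Sw_(a', a3 <- comul a) \Sw_(a1, a2 <- comul a')
    \Sw_(b', b3 <- comul b) \Sw_(b1, b2 <- comul b')
      (a1 ⊗ b1) ⊗ ((a2 ⊗ b2) ⊗ (a3 ⊗ b3))).
    apply: eq_sw => a' a3; rewrite sw_exch; apply: eq_sw => b' b3.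
    by rewrite sw_tcomul_tens; [|lin].
  rewrite coassoc; [|lin..]; apply: eq_sw => a1 a'.
  transitivity (\Sw_(a2, a3 <- comul a') \Sw_(b1, b' <- comul b)
    \Sw_(b2, b3 <- comul b') (a1 ⊗ b1) ⊗ ((a2 ⊗ b2) ⊗ (a3 ⊗ b3))).
    by apply: eq_sw => a2 a3; rewrite coassoc; [|lin..].
  rewrite sw_exch; apply: eq_sw => b1 b'.
  by rewrite sw_tcomul_tens; [|lin].
- apply: tensor_ext; [lin|lin|move=> a b].
  rewrite sw_tcomul_tens; last first.
    by split=> c; [exact: lin_scalel|exact: lin_scaler].
  rewrite -[in RHS](counitl a) -[in RHS](counitl b).
  rewrite (@linear_sweedler _ _ _ _ _ (fun u => u ⊗ _)); last by lin.
  apply: eq_sw => a1 a2; rewrite (@linear_sweedler _ _ _ _ _ (fun u => _ ⊗ u)); last by lin.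
  by apply: eq_sw => b1 b2; rewrite tcounit_tens tens_scalel tens_scaler scalerA.
- apply: tensor_ext; [lin|lin|move=> a b].
  rewrite sw_tcomul_tens; last first.
    by split=> c; [exact: lin_scaler|exact: lin_scalel].
  rewrite -[in RHS](counitr a) -[in RHS](counitr b).
  rewrite (@linear_sweedler _ _ _ _ _ (fun u => u ⊗ _)); last by lin.
  apply: eq_sw => a1 a2; rewrite (@linear_sweedler _ _ _ _ _ (fun u => _ ⊗ u)); last by lin.
  by apply: eq_sw => b1 b2; rewrite tcounit_tens tens_scalel tens_scaler scalerA.
Qed.

Lemma tensor_bialgebra : is_bialgebra (@tmul A B) (1 ⊗ 1) tcomul tcounit.
Proof.
have [l1 l2] := tmul_bilin A B; have lc := tcomul_linear.
have ls := tcounit_scalar.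
split; [exact: tmul_algebra|exact: tensor_coalgebra| | | |].
- apply: tensor_ext2.
  + split=> z; first by apply: lin_comp; [|exact: l1].
    by apply: lin_comp; [|exact: l2].
  + by split=> z; lin.
  move=> a b c d; rewrite tmul_tens sw_tcomul_tens; last first.
    by split=> z; lin.
  transitivity (\Sw_(a1, a2 <- comul a) \Sw_(b1, b2 <- comul b)
     \Sw_(c1, c2 <- comul c) \Sw_(d1, d2 <- comul d)
      ((a1 * c1) ⊗ (b1 * d1)) ⊗ ((a2 * c2) ⊗ (b2 * d2))); last first.
    apply: eq_sw => a1 a2; apply: eq_sw => b1 b2.
    rewrite sw_tcomul_tens; last by split=> z; lin.
    by apply: eq_sw => c1 c2; apply: eq_sw => d1 d2; rewrite !tmul_tens.
  rewrite /tcomul sweedler_tens; last by lin.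
  rewrite !(bialgebra_comulM (bialgebraP _)).
  rewrite sw_sw; last by lin.
  apply: eq_sw => a1 a2; rewrite sw_sw; last by lin.
  rewrite [RHS]sw_exch; apply: eq_sw => c1 c2.
  rewrite sweedler_tens; last by lin.
  rewrite sw_sw; last by lin.
  apply: eq_sw => b1 b2; rewrite sw_sw; last by lin.
  by apply: eq_sw => d1 d2; rewrite sweedler_tens //; lin.
- by rewrite /tcomul !(sweedler_tens, bialgebra_comul1 (bialgebraP _)) //; lin.
- move=> x y; apply: (@tensor_ext2 k A B A B k^o (fun x y => tcounit (tmul x y))
    (fun x y => tcounit x * tcounit y)).
  + split=> z; first by apply: scal_comp => //; exact: l1.
    by apply: scal_comp => //; exact: l2.
  + by split=> z; [exact: scal_mull|exact: scal_mulr].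
  move=> a b c d; rewrite tmul_tens !tcounit_tens.
  by rewrite !(bialgebra_counitM (bialgebraP _)) mulrACA.
- by rewrite tcounit_tens !(bialgebra_counit1 (bialgebraP _)) mulr1.
Qed.

End Bialgebra.

Lemma tensor_hopf (A B : hopf_algebra k) :
  is_hopf_algebra (@tmul A B) (1 ⊗ 1) (@tcomul A B) (@tcounit A B)
    (tmap (@antipode k A) (@antipode k B)).
Proof.
have [l1 l2] := tmul_bilin A B; have lc := @tcomul_linear A B.
have ls := @tcounit_scalar A B.
have lS : linear (tmap (@antipode k A) (@antipode k B)).
  by apply: tmap_linear; lin.
split => //; first exact: tensor_bialgebra.
- apply: tensor_ext; [| exact: lin_scalel |move=> a b].
    by apply: lin_sw => //; split=> z; [apply: lin_comp; [exact: l1|]|]; lin.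
  rewrite sw_tcomul_tens; last first.
    by split=> z; [apply: lin_comp; [exact: l1|]|]; lin.
  (* The scalar is distributed as ε(a)1 ⊗ ε(b)1, so that the antipode axiom of each factor applies
     separately. *)
  rewrite tcounit_tens -scalerA -tens_scaler -tens_scalel -!antipodel.
  rewrite [RHS](@linear_sweedler _ _ _ _ _ (fun u => u ⊗ _)); last by lin.
  apply: eq_sw => a1 a2; rewrite (@linear_sweedler _ _ _ _ _ (fun u => _ ⊗ u)); last by lin.
  by apply: eq_sw => b1 b2; rewrite tmap_tens ?tmul_tens //; lin.
- apply: tensor_ext; [| exact: lin_scalel |move=> a b].
    by apply: lin_sw => //; split=> z; [|apply: lin_comp; [exact: l2|]]; lin.
  rewrite sw_tcomul_tens; last first.
    by split=> z; [|apply: lin_comp; [exact: l2|]]; lin.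
  rewrite tcounit_tens -scalerA -tens_scaler -tens_scalel -!antipoder.
  rewrite [RHS](@linear_sweedler _ _ _ _ _ (fun u => u ⊗ _)); last by lin.
  apply: eq_sw => a1 a2; rewrite (@linear_sweedler _ _ _ _ _ (fun u => _ ⊗ u)); last by lin.
  by apply: eq_sw => b1 b2; rewrite tmap_tens ?tmul_tens //; lin.
Qed.

End TensorHopf.

(** * Transport of a Hopf algebra structure along a linear bijection *)

Section Transport.
Variables (k : fieldType) (V W : lmodType k) (f : V -> W) (g : W -> V).
Variables (mulV : V -> V -> V) (oneV : V) (comulV : V -> V ⊗ V) (counitV : V -> k)
  (SV : V -> V).
Variables (mulW : W -> W -> W) (oneW : W) (comulW : W -> W ⊗ W) (counitW : W -> k)
  (SW : W -> W).
Hypotheses (lf : linear f) (fK : cancel f g) (gK : cancel g f).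
Hypothesis f_mul : forall x y, f (mulV x y) = mulW (f x) (f y).
Hypothesis f_one : f oneV = oneW.
Hypothesis f_comul : forall x, tmap f f (comulV x) = comulW (f x).
Hypothesis f_counit : forall x, counitW (f x) = counitV x.
Hypothesis f_antipode : forall x, f (SV x) = SW (f x).

(** Identities with values in V are checked after applying the injective [f]. Those with values in
    tensor powers of V instead use the explicit form [comulVE] of the coproduct and are pushed back
    from W by [g], which avoids any injectivity statement for f ⊗ f. *)
Lemma transport_hopf : is_hopf_algebra mulW oneW comulW counitW SW ->
  is_hopf_algebra mulV oneV comulV counitV SV.
Proof.
have lg : linear g by move=> a x y; apply: (can_inj fK); rewrite lf !gK.
have lgg := tmap_linear lg lg.
have inj_f := can_inj fK.
case=> -[[bm mA m1 mr1] [lc ls cA cl cr] cM c1 sM s1] lS Sl Sr.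
have [m_l m_r] := bm.
have bmV : bilin mulV.
  by split=> [w a x y|v a x y]; apply: inj_f; rewrite f_mul !lf !f_mul ?m_l ?m_r.
have comulVE x : comulV x = tmap g g (comulW (f x)).
  rewrite -f_comul /tmap sw_tmap; last by lin.
  by rewrite -[LHS]sweedler_id; apply: eq_sw => a b; rewrite !fK.
have lcV : linear comulV.
  by move=> a x y; rewrite !comulVE lf lc lgg.
have swV (U : lmodType k) (h : V -> V -> U) x : bilin h ->
    sweedler h (comulV x) = \Sw_(x, y <- comulW (f x)) h (g x) (g y).
  by move=> bh; rewrite comulVE sw_tmap.
have lsV : scalar counitV by move=> a x y; rewrite -!f_counit lf ls.
have lSV : linear SV.
  by move=> a x y; apply: inj_f; rewrite f_antipode !lf !f_antipode lS.
have [mV_l mV_r] := bmV.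
split=> //; first split.
- split=> // [x y z|x|x]; apply: inj_f.
  + by rewrite !f_mul mA.
  + by rewrite f_mul f_one m1.
  + by rewrite f_mul f_one mr1.
- split=> // c.
  + have l3 : linear (tmap g (tmap g g)) by exact: tmap_linear.
    have := congr1 (tmap g (tmap g g)) (cA (f c)).
    rewrite !(linear_sweedler _ _ l3) => e.
    rewrite !swV; [|lin..].
    transitivity (\Sw_(x, y <- comulW (f c))
      tmap g (tmap g g) (\Sw_(x1, x2 <- comulW x) x1 ⊗ (x2 ⊗ y))).
      apply: eq_sw => x y; rewrite swV; last by lin.
      rewrite gK (linear_sweedler _ _ l3); apply: eq_sw => x1 x2.
      by rewrite !tmap_tens.
    rewrite e; apply: eq_sw => x y; rewrite swV; last by lin.
    rewrite gK (linear_sweedler _ _ l3); apply: eq_sw => x1 x2.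
    by rewrite !tmap_tens.
  + rewrite swV; last by split=> z; [exact: lin_scalel|exact: lin_scaler].
    apply: inj_f; rewrite (linear_sweedler _ _ lf) -[RHS]cl.
    by apply: eq_sw => x y; rewrite (linZ lf) gK -f_counit gK.
  + rewrite swV; last by split=> z; [exact: lin_scaler|exact: lin_scalel].
    apply: inj_f; rewrite (linear_sweedler _ _ lf) -[RHS]cr.
    by apply: eq_sw => x y; rewrite (linZ lf) gK -f_counit gK.
- move=> x y; rewrite comulVE f_mul cM swV; last first.
    by split=> z; apply: lin_sum => ? ?; [apply: lin_tensl|apply: lin_tensr].
  rewrite (linear_sweedler _ _ lgg); apply: eq_sw => x1 x2.
  rewrite swV; last by split=> z; [apply: lin_tensl|apply: lin_tensr].
  rewrite (linear_sweedler _ _ lgg); apply: eq_sw => y1 y2.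
  by rewrite tmap_tens //; congr (_ ⊗ _); apply: inj_f; rewrite f_mul !gK.
- by rewrite comulVE f_one c1 tmap_tens // -f_one fK.
- by move=> x y; rewrite -!f_counit f_mul sM.
- by rewrite -f_counit f_one s1.
- move=> x; rewrite swV; last exact: (@bilin_comp _ _ _ _ _ _ mulV).
  apply: inj_f; rewrite (linear_sweedler _ _ lf) (linZ lf) f_one.
  rewrite -f_counit -Sl; apply: eq_sw => y z.
  by rewrite f_mul f_antipode !gK.
- move=> x; rewrite swV; last exact: (@bilin_comp _ _ _ _ _ _ mulV).
  apply: inj_f; rewrite (linear_sweedler _ _ lf) (linZ lf) f_one.
  rewrite -f_counit -Sr; apply: eq_sw => y z.
  by rewrite f_mul f_antipode !gK.
Qed.

End Transport.

(** * Convolution inverses and cancellation in Sweedler sums *)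

Section SweedlerCalculus.
Variables (k : fieldType).

Lemma comulM (B : bialgebra k) (U : lmodType k) (f : B -> B -> U) (x y : B) :
  bilin f -> sweedler f (comul (x * y)) =
  \Sw_(x1, x2 <- comul x) \Sw_(y1, y2 <- comul y) f (x1 * y1) (x2 * y2).
Proof.
move=> bf; rewrite (bialgebra_comulM (bialgebraP B)) sw_sw //.
apply: eq_sw => x1 x2; rewrite sw_sw //; apply: eq_sw => y1 y2.
exact: sweedler_tens.
Qed.

(** A left inverse equals a right inverse in the convolution monoid: f = f * (g * h) = (f * g) * h =
    h. The target product is a bare function so that it can be [tmul], which is not packaged as an
    [algType]. *)
Lemma convolution_inverse_unique (C : bialgebra k) (A : lmodType k)
    (mul : A -> A -> A) (one : A) (f g h : C -> A) :
  is_algebra mul one -> linear f -> linear g -> linear h ->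
  (forall c, \Sw_(x, y <- comul c) mul (f x) (g y) = counit c *: one) ->
  (forall c, \Sw_(x, y <- comul c) mul (g x) (h y) = counit c *: one) ->
  f =1 h.
Proof.
move=> [[m1 m2] mA ml mr] lf lg lh fg gh c.
transitivity (\Sw_(x, y <- comul c) \Sw_(y1, y2 <- comul y)
   mul (mul (f x) (g y1)) (h y2)).
  rewrite -[LHS](@counitr_lin _ _ _ f c) //; apply: eq_sw => x y.
  transitivity (\Sw_(y1, y2 <- comul y) mul (f x) (mul (g y1) (h y2))).
    rewrite -linear_sweedler // gh (linZ (m2 _)).
    by rewrite mr.
  by apply: eq_sw => *; rewrite mA.
rewrite -(@coassoc k C A (fun x y z => mul (mul (f x) (g y)) (h z))).
- rewrite -[RHS](@counitl_lin _ _ _ h c) //; apply: eq_sw => x y.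
  rewrite -(linear_sweedler _ _ (m1 _)) fg (linZ (m1 _)).
  by rewrite ml.
- by move=> y z; apply: (lin_comp (m1 _)); apply: (lin_comp (m1 _)).
- by move=> y z; apply: (lin_comp (m1 _)); apply: (lin_comp (m2 _)).
- by move=> y z; apply: (lin_comp (m2 _)).
Qed.

Section Collapse.
Variables (B : bialgebra k) (e : B -> B -> B).
Hypotheses (be : bilin e)
  (e1 : forall b, \Sw_(x, y <- comul b) e x y = counit b *: 1).

(** Here [e] stands for S(x) y or x S(y). Coassociativity makes the two arguments of [e] halves of
    one coproduct, and the counit left by the contraction is absorbed by the third index. *)
Lemma collapsel (U : lmodType k) (f : B -> B -> U) b : bilin f ->
  \Sw_(x, b' <- comul b) \Sw_(y, z <- comul b') f (e x y) z = f 1 b.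
Proof.
move=> [f1 f2]; case: be => e_l e_r.
rewrite -(@coassoc k B U (fun x y z => f (e x y) z)).
- rewrite -[RHS](counitl_lin _ (f2 1)); apply: eq_sw => x z.
  by rewrite -(linear_sweedler _ _ (f1 z)) e1 (linZ (f1 z)).
- by move=> y z; apply: (lin_comp (f1 _)).
- by move=> y z; apply: (lin_comp (f1 _)).
- by move=> y z; apply: f2.
Qed.

Lemma collapser (U : lmodType k) (f : B -> B -> U) b : bilin f ->
  \Sw_(x, b' <- comul b) \Sw_(y, z <- comul b') f x (e y z) = f b 1.
Proof.
move=> [f1 f2]; case: be => e_l e_r.
rewrite -[RHS](counitr_lin _ (f1 1)); apply: eq_sw => x z.
by rewrite -(linear_sweedler _ _ (f2 x)) e1 (linZ (f2 x)).
Qed.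

End Collapse.

End SweedlerCalculus.

(** * The antipode and its inverse as anti-coalgebra maps *)

Section AntipodeCoalgebra.
Variables (k : fieldType) (H : hopf_algebra k).
Local Notation S := (@antipode k H).

Lemma bilin_Sl : bilin (fun x y : H => S x * y). Proof. by lin. Qed.
Lemma bilin_Sr : bilin (fun x y : H => x * S y). Proof. by lin. Qed.

Definition Sr_collapsel := @collapsel k H _ bilin_Sr (@antipoder k H).
Definition Sl_collapser := @collapser k H _ bilin_Sl (@antipodel k H).
Definition Sr_collapser := @collapser k H _ bilin_Sr (@antipoder k H).

Lemma counit_antipode h : counit (S h) = counit h.
Proof.
have lc : linear (counit : H -> k^o) := @counit_scalar k H.
have lcS : linear (fun h => counit (S h) : k^o).
  by apply: lin_comp lc (@antipode_linear k H).
(* The counit is applied to S(h_1) h_2 = ε(h) 1; on the left, ε(h_2) is absorbed and ε(S(h))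
   remains. *)
transitivity (counit (\Sw_(x, y <- comul h) S x * y)).
  rewrite -[LHS](counitr_lin h lcS) (linear_sweedler _ _ lc).
  by apply: eq_sw => x y; rewrite (bialgebra_counitM (bialgebraP H)) mulrC.
rewrite antipodel [LHS](linZ lc) (bialgebra_counit1 (bialgebraP H)).
exact: mulr1.
Qed.

(** In the convolution algebra of maps from H to H ⊗ H, the composite Δ∘S is a left inverse of Δ and
    h ↦ S(h_2) ⊗ S(h_1) a right inverse, so they agree. *)
Lemma comul_antipode h : comul (S h) = \Sw_(h1, h2 <- comul h) S h2 ⊗ S h1.
Proof.
move: h; apply: (@convolution_inverse_unique k H (H ⊗ H)%type (@tmul k H H) (1 ⊗ 1)
  (fun h => comul (S h)) (@comul k H)
  (fun h => \Sw_(h1, h2 <- comul h) S h2 ⊗ S h1));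
  [exact: tmul_algebra|lin|lin|lin| |].
- move=> h.
  transitivity (comul (\Sw_(x, y <- comul h) S x * y)).
    rewrite (linear_sweedler _ _ (@comul_linear _ _)); apply: eq_sw => x y.
    exact/esym/(bialgebra_comulM (bialgebraP H)).
  rewrite antipodel (linZ (@comul_linear _ _)).
  by rewrite (bialgebra_comul1 (bialgebraP H)).
- move=> h; have [t1 t2] := @tmul_bilin k H H.
  transitivity (\Sw_(x, y <- comul h) \Sw_(x1, x2 <- comul x) \Sw_(y1, y2 <- comul y)
     (x1 * S y2) ⊗ (x2 * S y1)).
    apply: eq_sw => x y; rewrite /tmul; apply: eq_sw => x1 x2.
    rewrite sw_sw; last by lin.
    by apply: eq_sw => y1 y2; rewrite sweedler_tens //; lin.
  rewrite coassoc; [|lin..].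
  (* In h_1 S(h_4) ⊗ h_2 S(h_3) only h_2 and h_3 are neighbours; they must contract before h_1 and
     h_4 can meet. *)
  transitivity (\Sw_(x1, x' <- comul h) \Sw_(u, y2 <- comul x')
     \Sw_(x2, y1 <- comul u) (x1 * S y2) ⊗ (x2 * S y1)).
    by apply: eq_sw => x1 x'; rewrite coassoc; [|lin..].
  transitivity (\Sw_(x1, x' <- comul h) (x1 * S x') ⊗ (1 : H)).
    apply: eq_sw => x1 x'.
    rewrite -(@counitl_lin k H _ (fun y => (x1 * S y) ⊗ (1 : H))); last by lin.
    apply: eq_sw => u y2; rewrite -(@linear_sweedler _ _ _ _ _ (fun v => _ ⊗ v)); last by lin.
    by rewrite antipoder tens_scaler.
  rewrite -(@linear_sweedler _ _ _ _ _ (fun v => v ⊗ _)); last by lin.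
  by rewrite antipoder tens_scalel.
Qed.

Lemma sw_antipode (U : lmodType k) (f : H -> H -> U) h : bilin f ->
  sweedler f (comul (S h)) = \Sw_(h1, h2 <- comul h) f (S h2) (S h1).
Proof.
move=> bf; rewrite comul_antipode sw_sw //; apply: eq_sw => *.
exact: sweedler_tens.
Qed.

Hypothesis S_bij : bijective S.
Local Notation Si := (@antipode_inv k H).

Lemma antipode_invM x y : Si (x * y) = Si y * Si x.
Proof. by apply: (bij_inj S_bij); rewrite antipodeM !antipode_invK. Qed.

Lemma antipode_inv1 : Si 1 = 1.
Proof. by apply: (bij_inj S_bij); rewrite antipode_invK // antipode1. Qed.

Lemma comul_antipode_inv h : comul (Si h) = \Sw_(h1, h2 <- comul h) Si h2 ⊗ Si h1.
Proof.
have lSi := antipode_inv_linear S_bij.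
(* With h = S(t), the flip produced by S cancels the one in the claimed formula and leaves t_1 ⊗
   t_2. *)
rewrite -[in RHS](antipode_invK S_bij h) sw_antipode; last by lin.
rewrite -[LHS]sweedler_id; apply: eq_sw => x y.
by rewrite !antipodeK.
Qed.

Lemma sw_antipode_inv (U : lmodType k) (f : H -> H -> U) h : bilin f ->
  sweedler f (comul (Si h)) = \Sw_(h1, h2 <- comul h) f (Si h2) (Si h1).
Proof.
move=> bf; rewrite comul_antipode_inv sw_sw //; apply: eq_sw => *.
exact: sweedler_tens.
Qed.

Lemma counit_antipode_inv h : counit (Si h) = counit h.
Proof. by rewrite -[in RHS](antipode_invK S_bij h) counit_antipode. Qed.

End AntipodeCoalgebra.

(** Extends [lin] to expressions containing maps whose bilinearity is only a hypothesis in the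
    context, such as a generic [f], or [adj_act] once its bilinearity has been introduced. *)
Ltac bilins := cbv beta; lazymatch goal with
  | |- bilin _ => split=> ?; bilins
  | |- forall _, _ => move=> ?; bilins
  | |- _ => first
  [ solve [lin]
  | apply: lin_sum => ? ?; bilins
  | apply: lin_sw; bilins
  | match goal with bf : bilin _ |- _ => first
      [ exact: bf.1 | exact: bf.2
      | apply: (lin_comp (bf.1 _)); bilins
      | apply: (lin_comp (bf.2 _)); bilins ] end ] end.

(** * The adjoint action and coaction and their compatibility *)

Section AdjointPair.
Variables (k : fieldType) (H : hopf_algebra k).
Local Notation S := (@antipode k H).
Implicit Types a b g h : H.

Lemma adj_act_bilin : bilin (@adj_act k H).
Proof. by rewrite /adj_act; lin. Qed.

Lemma adj_coact_linear : linear (@adj_coact k H).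
Proof. by rewrite /adj_coact; lin. Qed.

Lemma sw_adj_coact (U : lmodType k) (f : H -> H -> U) h : bilin f ->
  sweedler f (adj_coact h) =
  \Sw_(h1, h' <- comul h) \Sw_(h2, h3 <- comul h') f (S h1 * h3) h2.
Proof.
move=> bf; rewrite /adj_coact sw_sw //; apply: eq_sw => h1 h'.
by rewrite sw_sw //; apply: eq_sw => h2 h3; rewrite sweedler_tens.
Qed.

(** The commutation rule that moves h to the left of g: in h_1 S(h_2) g h_3 the first two indices
    contract. *)
Lemma mul_adj_act g h : \Sw_(h1, h2 <- comul h) h1 * adj_act g h2 = g * h.
Proof.
transitivity (\Sw_(h1, h' <- comul h) \Sw_(h2, h3 <- comul h')
    (h1 * S h2) * g * h3).
  by apply: eq_sw => h1 h'; rewrite /adj_act sw_mulr; apply: eq_sw => *; rewrite !mulrA.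
by rewrite (@Sr_collapsel _ _ _ (fun x y => x * g * y)) ?mul1r //; lin.
Qed.

(** The dual of [mul_adj_act]: h_1 S(h_2) h_4 ⊗ h_3 loses its first two factors. The exchanged order
    of what remains is where the coopposite coproduct comes from. *)
Lemma sw_mul_adj_coact (U : lmodType k) (f : H -> H -> U) h : bilin f ->
  \Sw_(h1, h2 <- comul h) \Sw_(c, h20 <- adj_coact h2) f (h1 * c) h20 =
  \Sw_(h1, h2 <- comul h) f h2 h1.
Proof.
move=> bf.
transitivity (\Sw_(h1, h' <- comul h) \Sw_(h2, h'' <- comul h')
   \Sw_(h3, h4 <- comul h'') f ((h1 * S h2) * h4) h3).
  apply: eq_sw => h1 h2; rewrite sw_adj_coact; last by bilins.
  by apply: eq_sw => *; apply: eq_sw => *; rewrite mulrA.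
rewrite (@Sr_collapsel _ _ _ (fun x y => \Sw_(h3, h4 <- comul y) f (x * h4) h3)).
  by apply: eq_sw => *; rewrite mul1r.
by bilins.
Qed.

(** The same contraction on the other side, h_3 S(h_4) in S(h_1) h_3 S(h_4) ⊗ h_2. *)
Lemma sw_adj_coact_mul (U : lmodType k) (f : H -> H -> U) h : bilin f ->
  \Sw_(h1, h2 <- comul h) \Sw_(c, h10 <- adj_coact h1) f (c * S h2) h10 =
  \Sw_(h1, h2 <- comul h) f (S h1) h2.
Proof.
move=> bf.
transitivity (\Sw_(h', h4 <- comul h) \Sw_(h1, h'' <- comul h')
   \Sw_(h2, h3 <- comul h'') f (S h1 * (h3 * S h4)) h2).
  apply: eq_sw => h1 h2; rewrite sw_adj_coact; last by bilins.
  by apply: eq_sw => *; apply: eq_sw => *; rewrite mulrA.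
rewrite coassoc; [|bilins..]; apply: eq_sw => h1 h'.
rewrite coassoc; [|bilins..].
by rewrite (@Sr_collapser _ _ _ (fun x y => f (S h1 * y) x)) ?mulr1 //; bilins.
Qed.

(** This combination occurs in [bicross_comul_act], [bicross_act_coact] and [bicross_coactM]. The
    last factor h_2 of S(h_1) g h_2 stands next to the coaction and is absorbed by
    [sw_mul_adj_coact]. *)
Lemma sw_adj_act_mul_coact (U : lmodType k) (f : H -> H -> U) g h : bilin f ->
  \Sw_(h1, h2 <- comul h) \Sw_(c, h20 <- adj_coact h2) f (adj_act g h1 * c) h20 =
  \Sw_(h1, h' <- comul h) \Sw_(h2, h3 <- comul h') f (S h1 * g * h3) h2.
Proof.
move=> bf; have lc := adj_coact_linear.
transitivity (\Sw_(h', h3 <- comul h) \Sw_(h1, h2 <- comul h')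
      \Sw_(c, h30 <- adj_coact h3) f (S h1 * g * (h2 * c)) h30).
  apply: eq_sw => h' h3; rewrite sw_exch; apply: eq_sw => c h30.
  rewrite /adj_act sw_mull (@linear_sweedler _ _ _ _ _ (fun u => f u _)); last by bilins.
  by apply: eq_sw => h1 h2; rewrite !mulrA.
rewrite coassoc; [|bilins..]; apply: eq_sw => h1 h'.
by rewrite (@sw_mul_adj_coact _ (fun x y => f (S h1 * g * x) y)) //; bilins.
Qed.

Lemma adj_comodule_coalgebra : @is_left_comodule_coalgebra k (cop H) H (@adj_coact k H).
Proof.
have lc := adj_coact_linear.
split=> // h.
- rewrite sw_adj_coact; last by rewrite /= /cop_comul; bilins.
  rewrite sw_adj_coact; last by bilins.
  (* Normal form of both sides. In H_cop the flip of Δ is undone on S(x) but not on y, so S(x) y has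
     coproduct S(x_1) y_2 ⊗ S(x_2) y_1, the same nesting as a coaction applied twice. *)
  transitivity (\Sw_(h1, t1 <- comul h) \Sw_(h2, t2 <- comul t1) \Sw_(h3, t3 <- comul t2)
     \Sw_(h4, h5 <- comul t3) (S h1 * h5) ⊗ ((S h2 * h4) ⊗ h3)).
    transitivity (\Sw_(a, t1 <- comul h) \Sw_(h1, h2 <- comul a) \Sw_(h3, t3 <- comul t1)
       \Sw_(h4, h5 <- comul t3) (S h1 * h5) ⊗ ((S h2 * h4) ⊗ h3)).
      apply: eq_sw => a t1; rewrite [RHS]sw_exch; apply: eq_sw => h3 t3.
      rewrite /= /cop_comul sw_tswap; last by bilins.
      rewrite comulM; last by bilins.
      by rewrite sw_antipode; last by bilins.
    by rewrite coassoc; [|bilins..].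
  apply: eq_sw => h1 t1.
  transitivity (\Sw_(a, h5 <- comul t1) \Sw_(h2, t <- comul a) \Sw_(h3, h4 <- comul t)
     (S h1 * h5) ⊗ ((S h2 * h4) ⊗ h3)).
    rewrite coassoc; [|bilins..]; apply: eq_sw => h2 t2.
    by rewrite coassoc; [|bilins..].
  by apply: eq_sw => a h5; rewrite sw_adj_coact; last by bilins.
- rewrite sw_adj_coact; last first.
    by split=> z; [exact: (lin_scalel _ (@counit_scalar k H))|exact: lin_scaler].
  rewrite -[RHS]counitl; apply: eq_sw => h1 h'.
  rewrite -[in RHS](counitr h') -sw_scale; apply: eq_sw => h2 h3 /=.
  by rewrite scalerA (bialgebra_counitM (bialgebraP H)) counit_antipode.
- rewrite sw_adj_coact; last by bilins.
  (* The factor h_3 from the coaction on the first half stands next to the coaction on [b], ready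
     for [sw_mul_adj_coact]. *)
  transitivity (\Sw_(h', b <- comul h) \Sw_(h1, a <- comul h') \Sw_(h2, h3 <- comul a)
    \Sw_(c, b0 <- adj_coact b) (S h1 * (h3 * c)) ⊗ (h2 ⊗ b0)); last first.
    apply: eq_sw => a b; rewrite sw_adj_coact; last by bilins.
    by do 3!apply: eq_sw => ? ?; rewrite mulrA.
  rewrite [RHS]coassoc; [|bilins..]; apply: eq_sw => h1 h'.
  rewrite [RHS]coassoc; [|bilins..]; rewrite coassoc; [|bilins..].
  apply: eq_sw => h2 t.
  by rewrite (@sw_mul_adj_coact _ (fun x y => (S h1 * x) ⊗ (h2 ⊗ y))) //; bilins.
- rewrite sw_adj_coact; last first.
    by split=> z; [exact: lin_scaler|exact: (lin_scalel _ (@counit_scalar k H))].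
  rewrite -[RHS](antipodel h); apply: eq_sw => h1 h'.
  by rewrite (@counitl_lin _ _ _ (fun x => S h1 * x)) //; lin.
Qed.

Lemma adj_module_algebra : is_right_module_algebra (H := H) (A := cop H) (@adj_act k H).
Proof.
split.
- exact: adj_act_bilin.
- move=> a; rewrite /adj_act (bialgebra_comul1 (bialgebraP H)) sweedler_tens; last by lin.
  by rewrite antipode1 mul1r mulr1.
- move=> a h h'; rewrite /adj_act comulM; last by lin.
  rewrite sw_exch; apply: eq_sw => x' y'; rewrite sw_mulr sw_mull.
  by apply: eq_sw => x y; rewrite antipodeM !mulrA.
- move=> a b h.
  (* [mul_adj_act] is read backwards as b h = h_1 (b ◁ h_2); the h_1 it creates completes S(h_1) a
     h_2 to an action on [a]. *)
  transitivity (\Sw_(h1, h' <- comul h) S h1 * a * (\Sw_(h2, h3 <- comul h') h2 * adj_act b h3)).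
    by apply: eq_sw => h1 h'; rewrite mul_adj_act !mulrA.
  transitivity (\Sw_(h1, h' <- comul h) \Sw_(h2, h3 <- comul h') S h1 * a * h2 * adj_act b h3).
    by apply: eq_sw => h1 h'; rewrite sw_mulr; apply: eq_sw => *; rewrite !mulrA.
  have [act1 act2] := adj_act_bilin.
  rewrite -coassoc; [|bilins..].
  by apply: eq_sw => h' h3; rewrite -sw_mull.
- move=> h; rewrite /adj_act -antipodel; apply: eq_sw => *; by rewrite mulr1.
Qed.

Lemma counit_adj_act g h : counit (adj_act g h) = counit g * counit h.
Proof.
have lc : linear (counit : H -> k^o) := @counit_scalar k H.
have lcS : linear (fun h => counit g * counit h : k^o).
  exact: scal_mulr (@counit_scalar k H).
rewrite /adj_act [LHS](linear_sweedler _ _ lc) -[RHS](counitl_lin h lcS).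
apply: eq_sw => x y; rewrite !(bialgebra_counitM (bialgebraP H)) counit_antipode.
by rewrite [RHS]mulrA [counit x * _]mulrC.
Qed.

Lemma adj_coact1 : adj_coact (1 : H) = 1 ⊗ 1.
Proof.
have c1 := bialgebra_comul1 (bialgebraP H).
rewrite /adj_coact c1 sweedler_tens; last by lin.
by rewrite c1 sweedler_tens ?antipode1 ?mulr1 //; lin.
Qed.

Lemma adj_act_coact g h :
  \Sw_(h1, h2 <- comul h) \Sw_(c, h10 <- adj_coact h1) (c * adj_act g h2) ⊗ h10 =
  \Sw_(h1, h2 <- comul h) \Sw_(c, h20 <- adj_coact h2) (adj_act g h1 * c) ⊗ h20.
Proof.
have lc := adj_coact_linear.
(* Common value of the two sides, reached by a cancellation on the right for one and on the left for
   the other. *)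
transitivity (\Sw_(h1, h' <- comul h) \Sw_(h2, h3 <- comul h') (S h1 * g * h3) ⊗ h2).
  transitivity (\Sw_(h1, h' <- comul h) \Sw_(h2, h3 <- comul h')
      \Sw_(c, h10 <- adj_coact h1) (c * S h2 * g * h3) ⊗ h10).
    apply: eq_sw => h1 h'; rewrite sw_exch; apply: eq_sw => c h10.
    rewrite /adj_act sw_mulr (@linear_sweedler _ _ _ _ _ (fun u => u ⊗ _)); last by lin.
    by apply: eq_sw => h2 h3; rewrite !mulrA.
  rewrite -coassoc; [|bilins..]; rewrite -[RHS]coassoc; [|bilins..].
  apply: eq_sw => h' h3.
  by rewrite (@sw_adj_coact_mul _ (fun x y => (x * g * h3) ⊗ y)) //; bilins.
by rewrite (@sw_adj_act_mul_coact _ (fun x y => x ⊗ y)) //; bilins.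
Qed.

(** Expanding the left side gives S(h_1) S(g_1) g_3 h_3 ⊗ g_2 h_2, where c = S(g_1) g_3 is
    conjugated by h exactly as in [sw_adj_act_mul_coact]. *)
Lemma adj_coactM g h : adj_coact (g * h) =
  \Sw_(c, g0 <- adj_coact g) \Sw_(h1, h2 <- comul h) \Sw_(d, h20 <- adj_coact h2)
    (adj_act c h1 * d) ⊗ (g0 * h20).
Proof.
have lc := adj_coact_linear; have bact := adj_act_bilin.
rewrite [RHS]sw_adj_coact; last by bilins.
rewrite {1}/adj_coact comulM; last by bilins.
apply: eq_sw => g1 g'.
transitivity (\Sw_(h1, h' <- comul h) \Sw_(g2, g3 <- comul g') \Sw_(h2, h3 <- comul h')
   (S h1 * (S g1 * g3) * h3) ⊗ (g2 * h2)).
  apply: eq_sw => h1 h'; rewrite comulM; last by bilins.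
  by apply: eq_sw => *; apply: eq_sw => *; rewrite antipodeM !mulrA.
rewrite sw_exch; apply: eq_sw => g2 g3.
by rewrite (@sw_adj_act_mul_coact _ (fun x y => x ⊗ (g2 * y))) //; bilins.
Qed.

(** In S(h_2) g_1 h_3 ⊗ S(h_1) g_2 h_4 the inner indices h_2, h_3 form an adjoint action on g_1,
    while the outer ones surround g_2. *)
Lemma sw_comul_adj_act (U : lmodType k) (f : H -> H -> U) g h : bilin f ->
  sweedler f (comul (adj_act g h)) =
  \Sw_(g1, g2 <- comul g) \Sw_(h1, h' <- comul h) \Sw_(h2, h3 <- comul h')
    f (adj_act g1 h2) (S h1 * g2 * h3).
Proof.
move=> bf; have bact := adj_act_bilin.
rewrite {1}/adj_act linear_sweedler; last by lin.
rewrite sw_sw //.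
transitivity (\Sw_(u, v <- comul h) \Sw_(h1, h2 <- comul u) \Sw_(g1, g2 <- comul g)
   \Sw_(h3, h4 <- comul v) f (S h2 * g1 * h3) (S h1 * g2 * h4)).
  apply: eq_sw => u v; rewrite comulM //.
  by rewrite comulM ?sw_antipode //; bilins.
rewrite coassoc; [|bilins..].
rewrite [RHS]sw_exch; apply: eq_sw => h1 h'.
transitivity (\Sw_(h2, v <- comul h') \Sw_(h3, h4 <- comul v) \Sw_(g1, g2 <- comul g)
   f (S h2 * g1 * h3) (S h1 * g2 * h4)).
  by apply: eq_sw => h2 v; rewrite sw_exch.
rewrite -coassoc; [|bilins..].
rewrite [RHS]sw_exch; apply: eq_sw => u h4; rewrite sw_exch; apply: eq_sw => g1 g2.
by rewrite (@linear_sweedler _ _ _ _ _ (fun u => f u _)) //; bilins.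
Qed.

(** The flip puts the outer term S(h_1) g_2 h_3 in first position, where [sw_adj_act_mul_coact]
    recognises it; the coproduct of H itself would put it second. *)
Lemma cop_comul_adj_act g h : @comul k (cop H) (adj_act g h) =
  \Sw_(g1, g2 <- @comul k (cop H) g) \Sw_(h1, h2 <- comul h)
    \Sw_(c, h20 <- adj_coact h2) (adj_act g1 h1 * c) ⊗ adj_act g2 h20.
Proof.
have lc := adj_coact_linear; have bact := adj_act_bilin.
rewrite /= /cop_comul sw_tswap; last by bilins.
rewrite /tswap sw_comul_adj_act; last by lin.
apply: eq_sw => g1 g2.
by rewrite (@sw_adj_act_mul_coact _ (fun x y => x ⊗ adj_act g1 y)) //; bilins.
Qed.

End AdjointPair.

(** * The isomorphism with the tensor product Hopf algebra *)

Section BicrossedAntipode.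
Variables (k : fieldType) (H : hopf_algebra k).
Hypothesis S_bij : bijective (@antipode k H).
Local Notation S := (@antipode k H).
Local Notation Si := (@antipode_inv k H).
Local Notation Hc := (cop_hopf S_bij).
Local Notation mulb := (@bicross_mul k H Hc (@adj_act k H)).
Local Notation comulb := (@bicross_comul k H Hc (@adj_coact k H)).
Local Notation antipodeb := (@bicross_antipode k H Hc (@adj_act k H) (@adj_coact k H)).

Definition untwist (x : H ⊗ H) : H ⊗ H :=
  \Sw_(a, b <- x) \Sw_(a1, a2 <- comul a) a1 ⊗ (a2 * b).

Definition retwist (x : H ⊗ H) : H ⊗ H :=
  \Sw_(a, b <- x) \Sw_(a1, a2 <- comul a) a1 ⊗ (S a2 * b).

Lemma untwist_linear : linear untwist.
Proof. by rewrite /untwist; lin. Qed.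

Lemma retwist_linear : linear retwist.
Proof. by rewrite /retwist; lin. Qed.

Lemma untwist_tens a b : untwist (a ⊗ b) = \Sw_(a1, a2 <- comul a) a1 ⊗ (a2 * b).
Proof. by rewrite /untwist sweedler_tens //; lin. Qed.

Lemma retwist_tens a b : retwist (a ⊗ b) = \Sw_(a1, a2 <- comul a) a1 ⊗ (S a2 * b).
Proof. by rewrite /retwist sweedler_tens //; lin. Qed.

Lemma untwistK : cancel untwist retwist.
Proof.
have l1 := untwist_linear; have l2 := retwist_linear.
apply: tensor_ext => [||a b]; [lin|lin|].
rewrite untwist_tens (linear_sweedler _ _ l2).
transitivity (\Sw_(a', a3 <- comul a) \Sw_(a1, a2 <- comul a') a1 ⊗ ((S a2 * a3) * b)).
  apply: eq_sw => a' a3; rewrite retwist_tens; apply: eq_sw => *.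
  by rewrite !mulrA.
rewrite coassoc; [|lin..].
by rewrite (@Sl_collapser _ _ _ (fun x y => x ⊗ (y * b))) ?mul1r //; lin.
Qed.

Lemma retwistK : cancel retwist untwist.
Proof.
have l1 := untwist_linear; have l2 := retwist_linear.
apply: tensor_ext => [||a b]; [lin|lin|].
rewrite retwist_tens (linear_sweedler _ _ l1).
transitivity (\Sw_(a', a3 <- comul a) \Sw_(a1, a2 <- comul a') a1 ⊗ ((a2 * S a3) * b)).
  apply: eq_sw => a' a3; rewrite untwist_tens; apply: eq_sw => *.
  by rewrite !mulrA.
rewrite coassoc; [|lin..].
by rewrite (@Sr_collapser _ _ _ (fun x y => x ⊗ (y * b))) ?mul1r //; lin.
Qed.

Lemma bicross_mul_tens (a b c d : H) : mulb (a ⊗ b) (c ⊗ d) =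
  (\Sw_(c1, c2 <- comul c) (a * c1) ⊗ (adj_act b c2 * d) : H ⊗ H).
Proof.
have bact := @adj_act_bilin k H.
rewrite /bicross_mul sweedler_tens; last by bilins.
by rewrite sweedler_tens; last by bilins.
Qed.

(** The second tensorand of the left side is a_2 c_2 (b ◁ c_3) d, and c_2 (b ◁ c_3) becomes b c_2:
    the action disappears. *)
Lemma untwist_mul x y : untwist (mulb x y) = @tmul k H H (untwist x) (untwist y).
Proof.
have l1 := untwist_linear; have tm := @tmul_bilin k H H.
have bact := @adj_act_bilin k H.
have bm : bilin (mulb : H ⊗ H -> H ⊗ H -> H ⊗ H).
  by rewrite /bicross_mul; bilins.
move: x y; apply: (@tensor_ext2 k H H H H (H ⊗ H)%type (fun x y => untwist (mulb x y))).
- split=> z; apply: (lin_comp l1); [exact: bm.1|exact: bm.2].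
- by apply: bilin_comp.
move=> a b c d; rewrite bicross_mul_tens (linear_sweedler _ _ l1).
transitivity (\Sw_(a1, a2 <- comul a) \Sw_(c', z <- comul c) \Sw_(c1, c2 <- comul c')
  (a1 * c1) ⊗ (a2 * (c2 * adj_act b z) * d)).
  rewrite [RHS]sw_exch; apply: eq_sw => c' z; rewrite untwist_tens comulM; last by lin.
  by apply: eq_sw => *; apply: eq_sw => *; rewrite !mulrA.
rewrite !untwist_tens (linear_sweedler _ _ (tm.1 _)); apply: eq_sw => a1 a2.
rewrite coassoc; [|bilins..].
rewrite (linear_sweedler _ _ (tm.2 _)); apply: eq_sw => c1 c2.
rewrite tmul_tens -(@linear_sweedler _ _ _ _ _ (fun u => _ ⊗ (_ * u * d))); last by lin.
by rewrite mul_adj_act !mulrA.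
Qed.

Lemma untwist_one : untwist (1 ⊗ 1) = 1 ⊗ 1.
Proof.
rewrite untwist_tens (bialgebra_comul1 (bialgebraP H)) sweedler_tens ?mulr1 //; lin.
Qed.

(** After [sw_mul_adj_coact], both sides are a_1 ⊗ a_4 b_2 ⊗ a_2 ⊗ a_3 b_1, in which a_4 b_2 and a_3
    b_1 are the two halves of a coopposite coproduct. *)
Lemma untwist_comul x :
  tmap untwist untwist (comulb x) = @tcomul k H (cop H) (untwist x).
Proof.
have l1 := untwist_linear; have lc := @adj_coact_linear k H.
have lcc : linear (@comul k (cop H)) := @comul_linear k (cop H).
have lt := @tcomul_linear k H (cop H).
have ltm : linear (tmap untwist untwist) by exact: tmap_linear.
move: x; apply: (@tensor_ext k H H _ (fun x => tmap untwist untwist (comulb x))).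
- apply: (lin_comp ltm); rewrite /bicross_comul; bilins.
- exact: lin_comp lt l1.
move=> a b; rewrite /bicross_comul sweedler_tens; last by bilins.
rewrite untwist_tens (linear_sweedler _ _ lt) (linear_sweedler _ _ ltm).
transitivity (\Sw_(a1, u <- comul a) \Sw_(a2, v <- comul u) \Sw_(a3, a4 <- comul v)
  \Sw_(b1, b2 <- comul b) (a1 ⊗ (a4 * b2)) ⊗ (a2 ⊗ (a3 * b1))).
  transitivity (\Sw_(a', z <- comul a) \Sw_(a1, a2 <- comul a') \Sw_(c, z0 <- adj_coact z)
    \Sw_(b1, b2 <- comul b) (a1 ⊗ (a2 * c * b2)) ⊗ untwist (z0 ⊗ b1)).
    apply: eq_sw => a' z; rewrite (linear_sweedler _ _ ltm) [RHS]sw_exch.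
    apply: eq_sw => c z0; rewrite (linear_sweedler _ _ ltm).
    rewrite [@comul _ _ _]/(tswap (@comul k H b)) sw_tswap; last by bilins.
    rewrite [RHS]sw_exch; apply: eq_sw => b1 b2.
    rewrite tmap_tens // (untwist_tens a').
    rewrite (@linear_sweedler _ _ _ _ _ (fun u => u ⊗ _)); last by lin.
    by apply: eq_sw => a1 a2; rewrite mulrA.
  rewrite coassoc; [|bilins..]; apply: eq_sw => a1 u.
  rewrite (@sw_mul_adj_coact _ _ _ (fun x y => \Sw_(b1, b2 <- comul b)
     (a1 ⊗ (x * b2)) ⊗ untwist (y ⊗ b1))); last by bilins.
  rewrite -coassoc; [|bilins..]; apply: eq_sw => a2 a4.
  rewrite [RHS]sw_exch; apply: eq_sw => b1 b2.
  by rewrite untwist_tens (@linear_sweedler _ _ _ _ _ (fun u => _ ⊗ u)); last by lin.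
symmetry; transitivity (\Sw_(a', z <- comul a) \Sw_(a1, a2 <- comul a')
  \Sw_(a3, a4 <- comul z) \Sw_(b1, b2 <- comul b)
  (a1 ⊗ (a4 * b2)) ⊗ (a2 ⊗ (a3 * b1))).
  apply: eq_sw => a' z; rewrite /tcomul sweedler_tens; last by bilins.
  apply: eq_sw => a1 a2.
  rewrite [@comul _ _ _]/(tswap (@comul k H (z * b))) sw_tswap; last by bilins.
  by rewrite (comulM (B := H)); last by bilins.
by rewrite coassoc; [|bilins..].
Qed.

Lemma untwist_counit x :
  @tcounit k H (cop H) (untwist x) = @bicross_counit k H Hc x.
Proof.
have l1 := untwist_linear.
pose ct : H ⊗ H -> k^o := @tcounit k H (cop H).
have ls : linear ct := @tcounit_scalar k H (cop H).
move: x; apply: (@tensor_ext k H H k^o (fun x => ct (untwist x)) ct) => // [|a b].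
  exact: lin_comp ls l1.
rewrite [RHS](@tcounit_tens k H (cop H) a b) untwist_tens (linear_sweedler _ _ ls).
transitivity (\Sw_(a1, a2 <- comul a) counit a2 *: (counit a1 * counit b : k^o)).
  apply: eq_sw => a1 a2; rewrite [LHS](@tcounit_tens k H (cop H)).
  by rewrite [@counit k (cop H) _](bialgebra_counitM (bialgebraP H)) mulrCA.
apply: (@counitr_lin k H k^o (fun a => counit a * counit b)).
exact: scal_mull (@counit_scalar k H).
Qed.

Lemma untwist_antipode x :
  untwist (antipodeb x) = tmap S Si (untwist x).
Proof.
have l1 := untwist_linear; have lc := @adj_coact_linear k H.
have lSi := antipode_inv_linear S_bij.
have lt : linear (tmap S Si) by apply: tmap_linear => //; lin.
have bact := @adj_act_bilin k H.
move: x; apply: (@tensor_ext k H H _ (fun x => untwist (antipodeb x))).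
- by apply: (lin_comp l1); rewrite /bicross_antipode; bilins.
- exact: lin_comp lt l1.
move=> a b; rewrite /bicross_antipode sweedler_tens; last by rewrite /=; bilins.
rewrite untwist_tens (linear_sweedler _ _ lt) (linear_sweedler _ _ l1) /=.
(* untwist (S(x_2) ⊗ (c ◁ S(x_1))) = S(x_2) ⊗ c S(x_1) *)
transitivity (\Sw_(c, a0 <- adj_coact a) \Sw_(a1, a2 <- comul a0) S a2 ⊗ (Si (c * b) * S a1)).
  apply: eq_sw => c a0; rewrite (linear_sweedler _ _ l1).
  (* S(x_2) ⊗ S(x_1) is the coproduct of the single element S(x), so that [mul_adj_act] can be
     applied to S(x). *)
  transitivity (\Sw_(y, z <- comul (S a0)) untwist (y ⊗ adj_act (Si (c * b)) z)).
    by rewrite sw_antipode //; bilins.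
  transitivity (\Sw_(y, z <- comul (S a0)) y ⊗ (Si (c * b) * z)).
    transitivity (\Sw_(u, z <- comul (S a0)) \Sw_(x, y <- comul u)
        x ⊗ (y * adj_act (Si (c * b)) z)).
      by apply: eq_sw => u z; rewrite untwist_tens.
    rewrite coassoc; [|bilins..]; apply: eq_sw => x u.
    rewrite -(@linear_sweedler _ _ _ _ _ (fun v => x ⊗ v)); last by lin.
    by rewrite mul_adj_act.
  by rewrite sw_antipode //; lin.
have SiM := antipode_invM S_bij.
rewrite sw_adj_coact; last by bilins.
(* S^{-1} turns the S(h_1) of the coaction back into h_1, which now meets S of the next index and
   cancels. *)
transitivity (\Sw_(h1, u <- comul a) \Sw_(a1, v <- comul u) \Sw_(a2, h3 <- comul v)
   S a2 ⊗ (Si b * Si h3 * (h1 * S a1))).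
  apply: eq_sw => h1 h'; rewrite -coassoc; [|bilins..].
  apply: eq_sw => h2 h3; apply: eq_sw => a1 a2.
  by rewrite !SiM antipodeK // !mulrA.
rewrite (@Sr_collapsel _ _ _ (fun x v => \Sw_(a2, h3 <- comul v)
   S a2 ⊗ (Si b * Si h3 * x))); last by bilins.
apply: eq_sw => a1 a2; rewrite tmap_tens //; last by lin.
by rewrite SiM mulr1.
Qed.

Lemma adj_bicrossproduct_hopf :
  is_hopf_algebra mulb (@bicross_one k H Hc) comulb (@bicross_counit k H Hc) antipodeb.
Proof.
apply: (transport_hopf untwist_linear untwistK retwistK untwist_mul untwist_one
  untwist_comul untwist_counit untwist_antipode).
(* The antipode of [Hc] is [Si] by definition, so the antipode here is the S ⊗ S^{-1} of
   [untwist_antipode]. *)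
exact: (@tensor_hopf k H Hc).
Qed.

(** This is [bicrossed_coact_phi] in the indices of H: reversing them turns b_3 S^{-1}(b_1) into b_1
    times the H_cop antipode of b_3. *)
Lemma adj_coact_antipode_inv b : adj_coact (Si b) =
  \Sw_(b1, b' <- comul b) \Sw_(b2, b3 <- comul b') (b3 * Si b1) ⊗ Si b2.
Proof.
have lSi := antipode_inv_linear S_bij.
rewrite /adj_coact sw_antipode_inv //; last by bilins.
transitivity (\Sw_(b', b3 <- comul b) \Sw_(b1, b2 <- comul b') (b3 * Si b1) ⊗ Si b2).
  apply: eq_sw => b' b3; rewrite sw_antipode_inv //; last by bilins.
  by apply: eq_sw => b1 b2; rewrite antipode_invK.
by rewrite coassoc; [|bilins..].
Qed.

End BicrossedAntipode.

(** * The bicrossed module structure given by S^{-1} *)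

Theorem theorem3p6 (k : fieldType) (H : hopf_algebra k)
    (S_bij : bijective (@antipode k H)) :
  @is_bicrossed_module k H (cop_hopf S_bij)
    (@adj_act k H) (@adj_coact k H) (@antipode_inv k H).
Proof.
have lSi := antipode_inv_linear S_bij; have SiM := antipode_invM S_bij.
split.
- split; last exact: adj_bicrossproduct_hopf.
  split.
  + exact: adj_comodule_coalgebra.
  + exact: adj_module_algebra.
  + exact: (@counit_adj_act k H).
  + exact: (@adj_coact1 k H).
  + exact: (@cop_comul_adj_act k H).
  + exact: (@adj_act_coact k H).
  + exact: (@adj_coactM k H).
- exact: S_bij.
(* S^{-1} reverses both products and coproducts; the opposite product and the coopposite coproduct
   on the source compensate for this. *)
- split=> [|x y||x|x].
  + exact: lSi.
  + exact: SiM.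
  + exact: antipode_inv1.
  + by rewrite comul_antipode_inv // [in RHS]/= /cop_comul sw_tswap; last by lin.
  + exact: (counit_antipode_inv S_bij).
- move=> b; rewrite adj_coact_antipode_inv //.
  rewrite /= /cop_comul sw_tswap; last by lin.
  rewrite -coassoc; [|lin..]; apply: eq_sw => b' b3.
  by rewrite sw_tswap; last by lin.
(* Termwise: S^{-1}(S(a_1) a_3) = S^{-1}(a_3) a_1. *)
- move=> a; rewrite [LHS](@sw_adj_coact k H _ (fun c a0 => antipode_inv c ⊗ a0)); last by lin.
  by do 2!apply: eq_sw => ? ?; rewrite SiM antipodeK.
- move=> b a; rewrite /adj_act linear_sweedler //; apply: eq_sw => a1 a2.
  by rewrite !SiM antipodeK // mulrA.
(* The action by S^{-1}(b) is b_2 b' S^{-1}(b_1), which is the required expression in the reversed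
   indices of H_cop. *)
- move=> b b'; rewrite /adj_act sw_antipode_inv //; last by lin.
  rewrite /= /cop_comul sw_tswap; last by lin.
  by apply: eq_sw => b1 b2; rewrite antipode_invK.
Qed.
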